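(* Fix a closed 3-dimensional triangulation $T$, with $T_0$ and $E$ some spanning trees of tetrahedra and edges of $T$. Then the following assertions are equivalent: (i) $T\in\mathbb T$ for the distinguished spanning trees $T_0$ and $E$, i.e. the 2-complex $T^{T_0}_E$ is a tree of triangles and $\mathsf{Cut}(E)$ is a spanning tree of $T^{T_0}_E$; (ii) there exists a tree-avoiding local construction of $T$ based on $T_0$ whose critical tree is $E$.
   Context: Complexes are finite, connected, oriented, non-degenerate CW-complexes up to homeomorphisms preserving the cell structure; non-degenerate means that the characteristic map of each cell restricts to a homeomorphism from each connected component of the preimage of the interior of a lower-dimensional cell onto that interior, and the preimage of a vertex is a set of vertices. A closed 3-dimensional triangulation $T$ is such a complex whose cells are all simplices and in which every triangle belongs to two (not necessarily distinct) tetrahedra. A spanning tree of tetrahedra $T_0$ of $T$ consists of all tetrahedra of $T$ glued along the triangles dual to the edges of a spanning tree of the dual graph (vertices = tetrahedra, edges = triangles); these triangles are the internal triangles of $T_0$, and $T_0$ is viewed as a triangulated 3-ball (''tree of tetrahedra'') with boundary a planar triangulation $\partial T_0$. A spanning tree of edges is a spanning tree of the 1-skeleton. An embedded 2-complex is a 2-complex $c$ with simplicial cells together with a non-degenerate continuous attachment map from a closed oriented (possibly disconnected) surface to $c$ such that the preimage of the interior of each triangle consists of exactly two open discs. $T^{T_0}$ is the embedded 2-complex obtained from $T$ by removing the internal triangles of $T_0$ (replacing $T_0$ by a single 3-cell with the same boundary); it has the same vertices and edges as $T$. $T^{T_0}_E$ is obtained from $T^{T_0}$ by duplicating each edge of $E$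 into one copy per triangle containing it, so that each copy belongs to a single triangle, and then splitting vertices so that triangles are kept attached through a vertex only if they are connected through triangles successively sharing edges containing this vertex. $\mathsf{Cut}(E)$ is the set of copies of edges of $E$. A tree of triangles is an embedded 2-complex whose incidence graph (one vertex per triangle, one per edge, adjacency when the triangle contains the edge) is a tree. $\mathbb T$ is the set of $T$ with marked $T_0$, $E$ satisfying the condition displayed in (i), together with a root (a marked oriented edge of $E$ and a marked triangle, not internal to $T_0$, containing it); the root plays no role in the condition. **Local constructions.** If $T_0$ has $2n$ boundary triangles, a local construction of $T$ based on $T_0$ is a sequence $T_0,T_1,\dots,T_n=T$ where $T_{s+1}$ is obtained from $T_s$ by choosing an edge $\sigma_{s+1}$ of $\partial T_s$ shared by two boundary triangles $A_{s+1},B_{s+1}$ and gluing these triangles together by folding along $\sigma_{s+1}$ (the two other pairs of edges sharing an endpoint of $\sigma_{s+1}$ are identified). The chosen edge is part of the data when the triangles share more than one edge. Let $\Sigma_{s}$ be the triangle of $T^{T_0}$ resulting from gluing $A_s$ and $B_s$. The complex obtained from $T^{T_0}$ by removing $\sigma_1,\Sigma_1,\dots,\sigma_n,\Sigma_n$ is a spanning tree of edges of $T$, called the critical tree of the local construction. **Tree-avoiding.** Let $E_0$ be a subset of edges of $\partial T_0$ that is spanning (every vertex has an incident edge in it). Along a local construction define $E_s$ recursively as the image of $E_{s-1}$ in $T_s$. The local construction avoids $E_0$ if at every step the chosen shared edge is not in $E_s$ and each pair of edges that become identified upon gluing is of matching type (both in $E_s$ or both not in $E_s$). A local construction is tree-avoiding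 if it avoids some spanning tree $E_0$ of $\partial T_0$.
   Formalization: T is taken as a gluing of tetrahedra along triangles, with no further identification of edges or vertices; the incidence graph and the copies of edges of E are counted once per side of a triangle (with multiplicity). The literal readings make the equivalence false. *)

(* Defs.v *)
From mathcomp Require Import all_boot all_fingroup.

Set Implicit Arguments.
Unset Strict Implicit.
Unset Printing Implicit Defensive.

(* Finite multigraphs: vertex set vs, edge set es, and ends k is the set of   *)
(* endpoints of k, a singleton when k is a loop.  A cycle is a list of pairs  *)
(* (x_i, k_i), all x_i distinct and all k_i distinct, where k_i joins x_i to  *)
(* x_(i+1) cyclically; loops and pairs of parallel edges are thus cycles.     *)
Section Multigraph.
Variables (V K : finType) (vs : {set V}) (es : {set K}) (ends : K -> {set V}).

Definition adjacent : rel V :=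
  fun x y => [exists k in es, ends k == [set x; y]].

Definition connected_graph : bool :=
  (vs != set0) && [forall x in vs, forall y in vs, connect adjacent x y].

Definition graph_cycle (c : seq (V * K)) : bool :=
  [&& c != [::], uniq (unzip1 c), uniq (unzip2 c), all [in es] (unzip2 c)
    & path.cycle (fun a b => ends a.2 == [set a.1; b.1]) c].

Definition is_tree : Prop :=
  connected_graph /\ forall c, ~~ graph_cycle c.

End Multigraph.

(* A flag (t, p) is the chain vertex {p 0} < edge {p 0, p 1} < triangle       *)
(* {p 0, p 1, p 2} < tetrahedron t, where the vertices of every tetrahedron   *)
(* are numbered 0, 1, 2, 3 compatibly with its orientation.                   *)
Definition flag (tet : finType) : finType := (tet * 'S_4)%type.

Definition i3 : 'I_4 := ord_max.

Section Complex.
Variable tet : finType.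
Notation flag := (flag tet).

(* A way to glue tetrahedra along triangles: g f is the flag identified with  *)
(* f on the other side of the triangle of f, and g f = f when this triangle   *)
(* is on the boundary.                                                        *)
Implicit Types (g : {ffun flag -> flag}) (f h : flag).

(* alpha g k f: the flag that differs from f exactly in dimension k           *)
Definition alpha g (k : 'I_4) f : flag :=
  if k == i3 then g f else (f.1, (tperm (inord k) (inord k.+1) * f.2)%g).

Definition same_facet f h : bool := (f.1 == h.1) && (f.2 i3 == h.2 i3).

(* Flags of the complex agreeing with f in all the dimensions listed in ds.   *)
(* This set stands for the cell of f when ds = [:: d], and for an incidence   *)
(* of two cells (counted with multiplicity) when ds has two elements.         *)
Definition cell g (ds : seq nat) f : {set flag} :=
  [set h | connect
     (fun u v => [exists k : 'I_4, (val k \notin ds) && (v == alpha g k u)])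
     f h].

Definition vertex g := cell g [:: 0].
Definition edge g := cell g [:: 1].
Definition triangle g := cell g [:: 2].
Definition edge_end g := cell g [:: 0; 1].
Definition side g := cell g [:: 1; 2].

Definition vertices g : {set {set flag}} := [set vertex g f | f : flag].
Definition edges g : {set {set flag}} := [set edge g f | f : flag].
Definition triangles g : {set {set flag}} := [set triangle g f | f : flag].

Definition edge_ends g (e : {set flag}) : {set {set flag}} :=
  [set vertex g f | f in e].

Definition dual_ends (s : {set flag}) : {set tet} := [set f.1 | f in s].

(* Triangles are glued in pairs of distinct facets of tetrahedra (possibly of *)
(* the same one) by simplicial orientation-reversing maps.  Such a complex is *)
(* non-degenerate: if an edge were identified with its reverse, alpha g 0 f   *)
(* would be reached from some f by alternating alpha g 2 and alpha g 3, an    *)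
(* odd number of times by parity; both commute with alpha g 0, so that the    *)
(* middle flag h satisfies alpha g k h = alpha g 0 h with k = 2, which is     *)
(* absurd, or k = 3, i.e. the facet of h is glued to itself.                  *)
Record closed_triangulation g : Prop := ClosedTriangulation {
  gluing_involutive : involutive g;
  gluing_simplicial :
    forall (k : 'I_4) f, k < 2 -> g (alpha g k f) = alpha g k (g f);
  gluing_facets : forall f, ~~ same_facet (g f) f;
  gluing_oriented : forall f, odd_perm (g f).2 = ~~ odd_perm f.2;
  gluing_connected : connected_graph [set: tet] (triangles g) dual_ends }.

(* A spanning tree of tetrahedra is given by its set of internal triangles.   *)
Definition tetrahedra_spanning_tree g (I : {set {set flag}}) : Prop :=
  I \subset triangles g /\ is_tree [set: tet] I dual_ends.

Definition edge_spanning_tree g (E : {set {set flag}}) : Prop :=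
  E \subset edges g /\ is_tree (vertices g) E (edge_ends g).

(* The tree of tetrahedra T_0: only the triangles of I remain glued.          *)
Definition tree_of_tetrahedra g (I : {set {set flag}}) : {ffun flag -> flag} :=
  [ffun f => if triangle g f \in I then g f else f].

Definition bd_vertices g : {set {set flag}} :=
  [set vertex g f | f : flag & g f == f].
Definition bd_edges g : {set {set flag}} :=
  [set edge g f | f : flag & g f == f].

Definition bd_spanning_tree g (E0 : {set {set flag}}) : Prop :=
  E0 \subset bd_edges g /\ is_tree (bd_vertices g) E0 (edge_ends g).

(* A step is encoded by a pair (a, b): a is a flag of the first triangle A, b *)
(* one of the second triangle B, both having the chosen edge sigma and the    *)
(* same endpoint of sigma, so that gluing a to b folds A onto B along sigma.  *)
Definition can_fold g (a b : flag) : bool :=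
  [&& g a == a, g b == b, ~~ same_facet a b & edge_end g a == edge_end g b].

Definition fold g (a b : flag) : {ffun flag -> flag} :=
  [ffun f => if same_facet f a then (b.1, (f.2 * a.2^-1 * b.2)%g)
             else if same_facet f b then (a.1, (f.2 * b.2^-1 * a.2)%g)
             else g f].

Fixpoint local_construction g (w : seq (flag * flag)) (T : {ffun flag -> flag})
    : Prop :=
  if w is (a, b) :: w' then can_fold g a b /\ local_construction (fold g a b) w' T
  else g = T.

(* The edges of the complex g containing the edges of a less glued complex    *)
Definition edge_image g (S : {set {set flag}}) : {set {set flag}} :=
  [set edge g f | f in cover S].

(* For a flag f of a triangle and of its side sigma: the side of the triangle *)
(* meeting sigma at the endpoint of f, then the one at the other endpoint.    *)
Definition other_edge1 g f := edge g (alpha g (inord 1) f).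
Definition other_edge2 g f := edge g (alpha g (inord 1) (alpha g ord0 f)).

Fixpoint avoids g (w : seq (flag * flag)) (S : {set {set flag}}) : Prop :=
  if w is (a, b) :: w' then
    [/\ edge g a \notin S,
        (other_edge1 g a \in S) = (other_edge1 g b \in S),
        (other_edge2 g a \in S) = (other_edge2 g b \in S)
      & avoids (fold g a b) w' (edge_image (fold g a b) S)]
  else True.

Definition tree_avoiding g (w : seq (flag * flag)) : Prop :=
  exists E0 : {set {set flag}}, bd_spanning_tree g E0 /\ avoids g w E0.

(* All triangles Sigma_s are removed too, hence only edges remain.            *)
Definition critical_tree (T : {ffun flag -> flag}) (w : seq (flag * flag))
    : {set {set flag}} :=
  edges T :\: [set edge T ab.1 | ab in w].

Section Cut.
Variables (g : {ffun flag -> flag}) (I E : {set {set flag}}).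

(* Flags whose triangle remains in T^{T_0}, the 2-complex obtained from T by  *)
(* removing the internal triangles of T_0 and the interior of T_0.            *)
Definition external f : bool := triangle g f \notin I.

Definition ext_triangles : {set {set flag}} :=
  [set triangle g f | f : flag & external f].
Definition ext_sides : {set {set flag}} :=
  [set side g f | f : flag & external f].

(* Edges of T^{T_0}_E: an edge of E is replaced with one copy for each side   *)
(* of a triangle of T^{T_0} along it, identified with this side.              *)
Definition cut_edge f : {set flag} :=
  if edge g f \in E then side g f else edge g f.
Definition cut_edges : {set {set flag}} :=
  [set cut_edge f | f : flag & external f].

Definition Cut : {set {set flag}} :=
  [set side g f | f : flag & external f && (edge g f \in E)].

(* The vertices of T^{T_0}_E are the classes of corners of triangles, two     *)
(* corners being kept attached when the triangles share an edge not in E with *)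
(* the same end at these corners.  The first two cases below only relate      *)
(* flags of one corner.                                                       *)
Definition attached : rel flag := fun f h =>
  [&& external f, external h
    & [|| h == alpha g (inord 1) f, h == g f
        | (edge g f \notin E) && (h \in edge_end g f)]].
Definition cut_vertex f : {set flag} := [set h | connect attached f h].
Definition cut_vertices : {set {set flag}} :=
  [set cut_vertex f | f : flag & external f].
Definition cut_edge_ends (e : {set flag}) : {set {set flag}} :=
  [set cut_vertex f | f in e].

(* The incidence graph has one edge for each side of a triangle, so that a    *)
(* triangle containing an edge twice yields a double edge.                    *)
Definition incidence_vertices : {set {set flag} + {set flag}} :=
  inl @: ext_triangles :|: inr @: cut_edges.
Definition incidence_ends (s : {set flag}) : {set {set flag} + {set flag}} :=
  [set inl (triangle g f) | f in s] :|: [set inr (cut_edge f) | f in s].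

Definition is_tree_of_triangles : Prop :=
  is_tree incidence_vertices ext_sides incidence_ends.

Definition Cut_spanning_tree : Prop :=
  is_tree cut_vertices Cut cut_edge_ends.

Definition in_TT : Prop := is_tree_of_triangles /\ Cut_spanning_tree.

End Cut.

End Complex.

(* Main.v *)
(** A local construction ending in [T] can only glue a facet of [T_0] to its
    partner in [T]; it is thus an ordering of the external triangles in which
    each triangle has an edge all of whose other sides are already glued.  Let
    [n] be the number of external triangles, [m] that of the edges of [T] not
    in [E], and [k] that of the sides in [Cut(E)].

    (ii) => (i): a construction avoids [E_0] exactly when [E_0] is the preimage
    of [E] in the boundary of [T_0].  As [E_0] is acyclic, the external
    triangles are connected through the edges not in [E]: the boundary of a
    union of classes would be an even subgraph of [E_0].  As [E_0] is connected
    on at least [n + 2] vertices, [k >= n + 1]; moreover [m = n].  The incidence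
    graph, with [n + m + k] vertices and [3 n] edges, is therefore a tree.
    Undoing the gluings from the last one shows that [Cut(E)] is connected, and
    counting the vertices of [T^{T_0}_E] that it is a tree.

    (i) => (ii): a nonempty set of external triangles having an even number of
    sides at every edge not in [E] would have an even subgraph of [Cut(E)] as
    its boundary.  By pigeonhole, every nonempty set [R] of external triangles
    then has an edge not in [E] with a single side in [R], and gluing along such
    edges is a construction with critical tree [E].  The same fact shows that
    the boundary triangles of [T_0] are connected through the edges outside the
    preimage [E_0] of [E]; by counting, this dual graph is a tree, so that [E_0]
    is connected, hence a spanning tree, again by counting. *)
Require Import Defs.
From mathcomp Require Import all_boot all_fingroup zify.

Set Implicit Arguments.
Unset Strict Implicit.
Unset Printing Implicit Defensive.

(** * Finite multigraphs: connectedness, leaves, and counting vertices against edges *)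

Section Graphs.
Variables (V K : finType) (ends : K -> {set V}).
Implicit Types (vs A B : {set V}) (es : {set K}).

(** Connectedness is used and proved below through these unions of components rather than through
    paths; as [[set x; y]] is unordered, the condition is symmetric in [x] and [y]. *)
Definition ends_closed es B :=
  forall k x y, k \in es -> ends k = [set x; y] -> x \in B -> y \in B.

Definition two_ended es := forall k, k \in es -> exists x y, ends k = [set x; y].

Definition acyclic es := forall c, ~~ graph_cycle es ends c.

Lemma acyclicS es es' : es' \subset es -> acyclic es -> acyclic es'.
Proof.
move=> /subsetP sub ac c; apply/negP => /and5P [c0 u1 u2 a1 pc].
case/negP: (ac c); apply/and5P; split=> //.
by apply/allP => k /(allP a1) /sub.
Qed.

Lemma connected_closed vs es B x :
  connected_graph vs es ends -> ends_closed es B ->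
  x \in vs -> x \in B -> vs \subset B.
Proof.
case/andP=> _ /forallP cn clB xvs xB; apply/subsetP => y yvs.
have /implyP/(_ xvs)/forallP/(_ y)/implyP/(_ yvs)/connectP [p pth ->] := cn x.
elim: p x xB pth {xvs} => //= z p IH x xB /andP [/existsP [k /andP [kes /eqP ek]] pth].
by apply: IH pth; apply: clB ek xB.
Qed.

Lemma closed_connected vs es x0 : x0 \in vs ->
  (forall B x, x \in vs -> x \in B -> ends_closed es B -> vs \subset B) ->
  connected_graph vs es ends.
Proof.
move=> x0vs h; apply/andP; split; first by apply/set0Pn; exists x0.
apply/forallP => x; apply/implyP => xvs; apply/forallP => y; apply/implyP => yvs.
have /subsetP/(_ y yvs) : vs \subset [set y | connect (adjacent es ends) x y].
  apply: (h _ x) => //; first by rewrite inE connect0.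
  move=> k u v kes ek; rewrite !inE => xu; apply: connect_trans xu (connect1 _).
  by apply/existsP; exists k; rewrite kes ek /=.
by rewrite inE.
Qed.

(** Grow [B] from [A] by one vertex at a time, along an edge leaving [B]: this edge becomes inner,
    so each new vertex uses up a new edge. Growth stops at a closed set. *)
Lemma card_dominated vs es A :
  (forall B, A \subset B -> ends_closed es B -> vs \subset B) ->
  #|vs| <= #|A| + #|es|.
Proof.
move=> h.
pose inner B := [set k in es | ends k \subset B].
have key : forall n B, #|~: B| <= n -> A \subset B -> #|B| <= #|A| + #|inner B| ->
    #|vs| <= #|A| + #|es|.
  elim=> [|n IH] B cB AB leB.
    have BT : B = setT.
      apply/eqP; rewrite -subTset; apply/subsetP => x _; apply/negPn/negP => xB.
      by move: cB; rewrite leqn0 cards_eq0 => /eqP/setP/(_ x); rewrite !inE xB.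
    apply: leq_trans (max_card _) _; rewrite -cardsT -BT; apply: leq_trans leB _.
    by rewrite leq_add2l; apply: subset_leq_card; apply/subsetP => k; rewrite inE => /andP [].
  case: (boolP [exists k in es, exists x in B, exists y, (y \notin B) && (ends k == [set x; y])]).
    case/existsP => k /andP [kes /existsP [x /andP [xB /existsP [y /andP [yB /eqP ek]]]]].
    apply: (IH (y |: B)).
    - have := cardsC B; have := cardsC (y |: B); rewrite cardsU1 yB; lia.
    - by apply: subset_trans AB (subsetUr _ _).
    - rewrite cardsU1 yB; suff: #|inner B| < #|inner (y |: B)| by lia.
      apply: proper_card; rewrite properE; apply/andP; split.
        apply/subsetP => l; rewrite !inE => /andP [-> /= s].
        by apply: subset_trans s (subsetUr _ _).
      apply/subsetPn; exists k; rewrite inE kes /= ek.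
        by apply/subsetP => z; rewrite !inE => /orP [/eqP->|->] //; rewrite xB orbT.
      by apply/negP => /subsetP/(_ y); rewrite !inE eqxx orbT (negbTE yB) => /(_ isT).
  move=> /negP nex.
  have sub : vs \subset B.
    apply: h => // k x y kes ek xB; apply/negPn/negP => yB; apply: nex.
    by apply/existsP; exists k; rewrite kes; apply/existsP; exists x; rewrite xB;
      apply/existsP; exists y; rewrite yB ek /=.
  apply: leq_trans (subset_leq_card sub) (leq_trans leB _).
  by rewrite leq_add2l; apply: subset_leq_card; apply/subsetP => k; rewrite inE => /andP [].
by apply: (key _ A) => //; rewrite leq_addr.
Qed.

(** [A] picks one representative vertex for each class of [cls]; as each class lies within a
    component, these representatives dominate [vs]. *)
Lemma card_components (X W : finType) (node : X -> V) (cls : X -> W) (D : {set X}) vs es :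
  (forall B x y, ends_closed es B -> x \in D -> y \in D -> cls y = cls x ->
    node x \in B -> node y \in B) ->
  (forall B, ends_closed es B -> node @: D \subset B -> vs \subset B) ->
  #|vs| <= #|cls @: D| + #|es|.
Proof.
move=> hcls hD.
pose rep w := omap node [pick x in D | cls x == w].
pose A := [set v | Some v \in rep @: (cls @: D)].
have cA : #|A| <= #|cls @: D|.
  rewrite -(card_imset (mem A) Some_inj); apply: leq_trans (leq_imset_card rep _).
  by apply: subset_leq_card; apply/subsetP => _ /imsetP [v vA ->]; move: vA; rewrite inE.
apply: leq_trans (leq_add cA (leqnn _)); apply: card_dominated => B /subsetP AB clB.
apply: (hD _ clB); apply/subsetP => _ /imsetP [y yD ->].
(* The trivial equation keeps a record of the value of [pick] while the other copy is destructed. *)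
have : [pick x in D | cls x == cls y] = [pick x in D | cls x == cls y] by [].
case: {2}[pick x in D | _] / pickP => [x /andP [xD /eqP exy] epick|/(_ y)];
  last by rewrite yD eqxx.
apply: (hcls B x y) => //; apply: AB; rewrite inE; apply/imsetP.
by exists (cls y); [apply: imset_f | rewrite /rep epick].
Qed.

Lemma connected_card vs es : connected_graph vs es ends -> #|vs| <= #|es|.+1.
Proof.
move=> cn; have /andP [/set0Pn [x xvs] _] := cn.
have := @card_dominated vs es [set x]; rewrite cards1 add1n; apply=> B xB clB.
by apply: connected_closed cn clB xvs _; rewrite -sub1set.
Qed.

Lemma acyclic_no_loop es k x : acyclic es -> k \in es -> ends k <> [set x; x].
Proof.
move=> ac kes ek; case/negP: (ac [:: (x, k)]).
by rewrite /graph_cycle /= kes ek eqxx.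
Qed.

Let step (a b : V * K) := ends a.2 == [set a.1; b.1].

(** Without a leaf, a simple path can be prolonged at its head by an edge other than its first one;
    it then closes into a cycle or ends up with more than [#|V|] distinct vertices. *)
Lemma acyclic_leaf es : two_ended es -> acyclic es -> es != set0 ->
  exists k x y, [/\ k \in es, ends k = [set x; y], x != y
    & forall k', k' \in es -> x \in ends k' -> k' = k].
Proof.
move=> te ac /set0Pn [k0 k0es].
case: (boolP [exists k in es, exists x, exists y, [&& ends k == [set x; y], x != y
    & [forall k' in es, (x \in ends k') ==> (k' == k)]]]).
  case/existsP => k /andP [kes /existsP [x /existsP [y /and3P [/eqP ek xy /forallP h]]]].
  exists k, x, y; split=> // k' k'es xk'.
  by have := h k'; rewrite k'es xk' => /eqP.
move=> /negP nleaf; exfalso.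
have next k x : k \in es -> x \in ends k ->
    exists k' u, [/\ k' \in es, k' != k & ends k' = [set u; x]].
  move=> kes xk.
  have [y ek] : exists y, ends k = [set x; y].
    have [a [b ek]] := te k kes; move: xk; rewrite ek !inE => /orP [] /eqP->.
      by exists b.
    by exists a; rewrite setUC.
  have xy : x != y by apply/eqP => exy; move: ek; rewrite -exy; apply: acyclic_no_loop kes.
  have /existsP [k' /andP [k'es nk']] : [exists k' in es, (x \in ends k') && (k' != k)].
    apply: contraT => /existsPn nk'; case: nleaf; apply/existsP; exists k; rewrite kes.
    apply/existsP; exists x; apply/existsP; exists y; rewrite ek eqxx xy /=.
    by apply/forallP => k'; move: (nk' k'); case: (k' \in es); case: (x \in _); case: eqP.
  move: nk' => /andP [xk' kk'].
  have [a [b ek']] := te k' k'es; move: xk'; rewrite ek' !inE => /orP [] /eqP->.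
    by exists k', b; rewrite ek' setUC.
  by exists k', a; rewrite ek'.
(* [n] bounds the number of further prolongations: the path already has [size p + 1] distinct
   vertices. *)
have key : forall n x k (p : seq (V * K)), #|V| < n + (size p).+1 ->
    path step (x, k) p -> uniq (unzip1 ((x, k) :: p)) -> uniq (unzip2 ((x, k) :: p)) ->
    all (fun a => (a.2 \in es) && (a.1 \in ends a.2)) ((x, k) :: p) -> False.
  elim=> [|n IH] x k p szp pth u1 u2 al.
    by have := max_card (mem (unzip1 ((x, k) :: p))); move/card_uniqP: u1 => ->;
      rewrite /= size_map; move: szp; rewrite add0n ltnS => h1 h2; have := leq_trans h2 h1;
      rewrite ltnn.
  have [k' [u [k'es nk' ek']]] : exists k' u, [/\ k' \in es, k' != k & ends k' = [set u; x]].
    by apply: next; move: al => /= /andP [/andP []].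
  have nux : u != x by apply/eqP => ux; move: ek'; rewrite ux; apply: acyclic_no_loop ac k'es.
  have notin : forall q, {subset q <= p} -> u \notin unzip1 q -> k' \notin unzip2 q.
    move=> q sub uq; apply/mapP => [[[y l] inq /= el]].
    have yp : (y, l) \in p by apply: sub.
    have := allP al (y, l); rewrite inE yp orbT => /(_ isT) /= /andP [_].
    rewrite -el ek' !inE => /orP [] /eqP ey.
      by case/negP: uq; rewrite -ey; apply/mapP; exists (y, l).
    by move: u1 => /= /andP [/negP []]; rewrite -ey; apply/mapP; exists (y, l).
  case: (boolP (u \in unzip1 p)) => up; last first.
    apply: (IH u k' ((x, k) :: p)) => /=.
    - by rewrite addSnnS in szp.
    - by rewrite /step /= ek' eqxx.
    - by move: u1 => /= ->; rewrite inE negb_or nux up.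
    - by move: u2 => /= ->; rewrite inE negb_or nk' /= andbT; apply: notin.
    - by move: al => /= ->; rewrite k'es ek' !inE eqxx.
  (* The new vertex [u] is already on the path: the part of the path up to [u], closed by [k'], is a
     cycle. *)
  case/mapP: up => [[u' l]] /= inp eu; subst u'.
  case/splitPr: inp => p1 p2 in pth u1 u2 al notin szp *.
  move: pth; rewrite cat_path /= => /and3P [pth1 st _].
  have u1' : uniq (x :: unzip1 p1 ++ [:: u]).
    move: u1; rewrite /unzip1 /= map_cat /= !cat_uniq !mem_cat !inE /= !negb_or.
    by case/and4P => /and3P [-> -> _] -> /andP [-> _] _.
  have u2' : uniq (k :: unzip2 p1).
    move: u2; rewrite /unzip2 /= map_cat /= cat_uniq mem_cat negb_or.
    by case/and3P => /andP [-> _] ->.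
  case/negP: (ac ((x, k) :: rcons p1 (u, k'))); apply/and5P; split=> //.
  - by rewrite /unzip1 /= map_rcons /= -cats1.
  - move: u2'; rewrite /unzip2 /= map_rcons mem_rcons rcons_uniq inE negb_or eq_sym nk' /= =>
    /andP [-> ->]; rewrite andbT.
    apply: notin; first by move=> z; rewrite mem_cat => ->.
    by move: u1' => /= /andP [_]; rewrite cat_uniq /= orbF => /and3P [].
  - apply/allP => l'; rewrite /unzip2 /= map_rcons inE mem_rcons inE => /or3P [/eqP->|/eqP->//|].
      by move: al => /= /andP [/andP []].
    case/mapP => b bp1 ->; have := allP al b; rewrite inE mem_cat bp1 orbT => /(_ isT).
    by case/andP.
  rewrite /= rcons_path rcons_path /= pth1 /=; apply/andP; split=> //.
  by rewrite last_rcons /= ek'.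
have [x [y ek0]] := te k0 k0es.
apply: (key #|V| x k0 [::]) => //=; first by rewrite addn1.
by rewrite k0es ek0 !inE eqxx.
Qed.

(** Remove a leaf together with its only edge, and induct on the number of edges. *)
Lemma acyclic_card vs es x0 : two_ended es -> acyclic es ->
  (forall k, k \in es -> ends k \subset vs) -> x0 \in vs -> #|es| < #|vs|.
Proof.
move: {2}#|es| (erefl #|es|) => n; elim: n es vs x0 => [|n IH] es vs x0 ces te ac sub x0vs.
  by rewrite ces; apply/card_gt0P; exists x0.
have es0 : es != set0 by rewrite -card_gt0 ces.
have [k [x [y [kes ek xy leaf]]]] := acyclic_leaf te ac es0.
have xvs : x \in vs by apply: (subsetP (sub k kes)); rewrite ek !inE eqxx.
have yvs : y \in vs by apply: (subsetP (sub k kes)); rewrite ek !inE eqxx orbT.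
have sub1 : es :\ k \subset es by apply: subsetDl.
have := IH (es :\ k) (vs :\ x) y; rewrite (cardsD1 x vs) xvs (cardsD1 k es) kes.
move: ces; rewrite (cardsD1 k es) kes add1n => - [ces]; rewrite ltnS; apply=> //.
- by move=> l /(subsetP sub1); apply: te.
- by apply: acyclicS ac.
- move=> l; rewrite !inE => /andP [lk les]; rewrite subsetD1 sub //=.
  by apply/negP => xl; case/eqP: lk; apply: leaf.
- by rewrite !inE eq_sym xy.
Qed.

(** Deleting an edge [k] of a cycle keeps the graph connected, and [connected_card] then contradicts
    the count. *)
Lemma connected_acyclic vs es : connected_graph vs es ends -> #|es| < #|vs| ->
  acyclic es.
Proof.
move=> cn lt [//|[x k] c]; apply/negP => /and5P [_ u1 u2 a1 pc].
have kes : k \in es by move: a1 => /= /andP [].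
have /andP [/set0Pn [x0 x0vs] _] := cn.
suff cn' : connected_graph vs (es :\ k) ends.
  by have := connected_card cn'; move: lt; rewrite (cardsD1 k es) kes; lia.
apply: (closed_connected x0vs) => B y yvs yB clB; apply: connected_closed cn _ yvs yB.
have same : forall b p, path step b p ->
    {subset unzip2 (belast b p) <= es :\ k} -> (b.1 \in B) = ((last b p).1 \in B).
  move=> b p; elim: p b => //= b' p IH b /andP [/eqP eb pth] s.
  have bes : b.2 \in es :\ k by apply: s; rewrite inE eqxx.
  rewrite -(IH b') //; last by move=> l lin; apply: s; rewrite inE lin orbT.
  apply/idP/idP; first exact: clB bes eb.
  by apply: clB bes _; rewrite setUC.
(* The rest of the cycle leads from one end of [k] to the other within [es :\ k], so a set closed
   under these edges contains both ends or neither. *)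
have [x' [ek hB]] : exists x', ends k = [set x; x'] /\ (x' \in B) = (x \in B).
  case: c {a1} u1 u2 a1 pc => [|[x' k'] c] u1 u2 a1 /=.
    by rewrite andbT => /eqP ek; exists x.
  case/andP => /eqP ek pc; exists x'; split=> //.
  have := same _ _ pc; rewrite last_rcons => -> //.
  rewrite belast_rcons => l lin; rewrite !inE; apply/andP; split.
    by move: u2 => /= /andP [/negP nk _]; apply/eqP => elk; apply: nk; rewrite -elk.
  by apply: (allP a1); rewrite inE; apply/orP; right.
move=> l u v les el uB; case: (eqVneq l k) => [elk|nlk]; last first.
  by apply: clB el uB; rewrite !inE nlk.
have : v \in [set x; x'] by rewrite -ek -elk el !inE eqxx orbT.
have : u \in [set x; x'] by rewrite -ek -elk el !inE eqxx.
by rewrite !inE => /orP [] /eqP eu /orP [] /eqP ->; move: uB; rewrite eu ?hB.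
Qed.

Lemma connected_tree vs es : connected_graph vs es ends -> #|es| < #|vs| ->
  is_tree vs es ends.
Proof. by move=> cn lt; split=> //; apply: connected_acyclic cn lt. Qed.

Lemma tree_card vs es : two_ended es -> (forall k, k \in es -> ends k \subset vs) ->
  is_tree vs es ends -> #|vs| = #|es|.+1.
Proof.
move=> te sub [cn ac]; apply/eqP; rewrite eqn_leq connected_card //=.
by have /andP [/set0Pn [x xvs] _] := cn; apply: acyclic_card xvs.
Qed.

End Graphs.

(** * The symmetric group on the four vertices of a tetrahedron *)

Section Perm4.
Local Open Scope group_scope.

Definition o0 : 'I_4 := @Ordinal 4 0 isT.
Definition o1 : 'I_4 := @Ordinal 4 1 isT.
Definition o2 : 'I_4 := @Ordinal 4 2 isT.
Definition o3 : 'I_4 := @Ordinal 4 3 isT.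

Lemma ord4P (i : 'I_4) : [\/ i = o0, i = o1, i = o2 | i = o3].
Proof.
case: i => [[|[|[|[|i]]]] lt] //;
  [constructor 1 | constructor 2 | constructor 3 | constructor 4]; exact: val_inj.
Qed.

Lemma inord4 : [/\ inord 0 = o0, inord 1 = o1, inord 2 = o2 & inord 3 = o3].
Proof. by split; apply: val_inj; rewrite /= inordK. Qed.

Lemma i3E : i3 = o3. Proof. exact: val_inj. Qed.

Definition s0 : 'S_4 := tperm o0 o1.
Definition s1 : 'S_4 := tperm o1 o2.
Definition s2 : 'S_4 := tperm o2 o3.

Lemma perm4P (p q : 'S_4) : p o0 = q o0 -> p o1 = q o1 -> p o2 = q o2 -> p o3 = q o3 -> p = q.
Proof. by move=> h0 h1 h2 h3; apply/permP => i; case: (ord4P i) => ->. Qed.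

Lemma s0s2C : s0 * s2 = s2 * s0.
Proof. by apply: perm4P; rewrite !permM !permE. Qed.

Lemma s0s1_braid : s0 * s1 * s0 = s1 * s0 * s1.
Proof. by apply: perm4P; rewrite !permM !permE. Qed.

Lemma s1s2_braid : s1 * s2 * s1 = s2 * s1 * s2.
Proof. by apply: perm4P; rewrite !permM !permE. Qed.

(** The stabilizer of [o3] is the symmetric group on the three others, generated by [s0] and
    [s1]. *)
Lemma perm4_fix3 (q : 'S_4) : q o3 = o3 ->
  q \in [:: 1; s0; s1; s0 * s1; s1 * s0; s0 * (s1 * s0)].
Proof.
move=> q3.
have n (i j : 'I_4) : i != j -> q i != q j by move=> ij; rewrite (inj_eq perm_inj).
have n01 := n o0 o1 isT; have n02 := n o0 o2 isT; have n12 := n o1 o2 isT.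
have n03 := n o0 o3 isT; have n13 := n o1 o3 isT; have n23 := n o2 o3 isT.
rewrite q3 {n} in n03 n13 n23.
have E (p : 'S_4) : q o0 = p o0 -> q o1 = p o1 -> q o2 = p o2 -> p o3 = o3 -> q == p.
  by move=> h0 h1 h2 h3; apply/eqP/perm4P => //; rewrite q3 h3.
rewrite !inE; case: (ord4P (q o0)) n01 n02 n03 => e0; rewrite e0 //;
case: (ord4P (q o1)) n12 n13 => e1; rewrite e1 //;
case: (ord4P (q o2)) n23 => e2; rewrite e2 // => *.
- by rewrite (E 1) // ?e0 ?e1 ?e2 !permE.
- by rewrite (E s1) ?orbT // ?e0 ?e1 ?e2 !permE.
- by rewrite (E s0) ?orbT // ?e0 ?e1 ?e2 !permE.
- by rewrite (E (s1 * s0)) ?orbT // ?e0 ?e1 ?e2 !permM !permE.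
- by rewrite (E (s0 * s1)) ?orbT // ?e0 ?e1 ?e2 !permM !permE.
- by rewrite (E (s0 * (s1 * s0))) ?orbT // ?e0 ?e1 ?e2 !permM !permE.
Qed.
End Perm4.

(** * Counting by fibres, and parity from involutions *)

Section Counting.

Lemma card_fibers_ge (X W : finType) (phi : X -> W) (D : {set X}) c :
  (forall x, x \in D -> c <= #|[set y in D | phi y == phi x]|) ->
  c * #|phi @: D| <= #|D|.
Proof.
move=> h; rewrite -[leqRHS]sum1_card (partition_big_imset phi) /= mulnC -sum_nat_const.
by apply: leq_sum => w /imsetP [x xD ->]; rewrite sum1dep_card; apply: h.
Qed.

Lemma card_fibers_le (X W : finType) (phi : X -> W) (D : {set X}) c :
  (forall x, x \in D -> #|[set y in D | phi y == phi x]| <= c) ->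
  #|D| <= c * #|phi @: D|.
Proof.
move=> h; rewrite -[leqLHS]sum1_card (partition_big_imset phi) /= mulnC -sum_nat_const.
by apply: leq_sum => w /imsetP [x xD ->]; rewrite sum1dep_card; apply: h.
Qed.

Lemma card_fibers (X W : finType) (phi : X -> W) (D : {set X}) c :
  (forall x, x \in D -> #|[set y in D | phi y == phi x]| = c) ->
  #|D| = c * #|phi @: D|.
Proof.
by move=> h; apply/eqP; rewrite eqn_leq card_fibers_le ?card_fibers_ge // => x xD; rewrite h.
Qed.

(** The orbits [[set x; phi x]] are the fibres of a map, and all have two elements. *)
Lemma even_involution (X : finType) (phi : X -> X) (S : {set X}) :
  (forall x, x \in S -> [/\ phi x \in S, phi (phi x) = x & phi x != x]) -> ~~ odd #|S|.
Proof.
move=> h; rewrite (@card_fibers _ _ (fun x => [set x; phi x]) S 2) ?oddM // => x xS.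
have [pS pK pn] := h x xS; rewrite (_ : finset _ = [set x; phi x]) ?cards2 1?eq_sym ?pn //.
apply/setP => y; rewrite !inE; apply/andP/idP => [[yS /eqP/setP/(_ y)]|].
  by rewrite !inE eqxx.
by case/orP => /eqP ->; rewrite ?pK // setUC.
Qed.

End Counting.

(** * Flags of a tetrahedron and the moves that change one of their cells *)

Section Flags.
Variable tet : finType.
Notation flag := (flag tet).
Implicit Types (f h : flag).

(** The moves [alpha g k] for [k < 3], which do not depend on the gluing [g]. *)
Definition a0 f : flag := (f.1, s0 * f.2)%g.
Definition a1 f : flag := (f.1, s1 * f.2)%g.
Definition a2 f : flag := (f.1, s2 * f.2)%g.
Definition sgn f : bool := odd_perm f.2.
(* A facet of a tetrahedron is named after the opposite vertex. *)
Definition facet f : tet * 'I_4 := (f.1, f.2 o3).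
Definition corner f : tet * 'I_4 := (f.1, f.2 o0).

(** Unfolding equations, for use once [a0], [a1] and [a2] have been made opaque. *)
Lemma a0E f : a0 f = (f.1, s0 * f.2)%g. Proof. by []. Qed.
Lemma a1E f : a1 f = (f.1, s1 * f.2)%g. Proof. by []. Qed.
Lemma a2E f : a2 f = (f.1, s2 * f.2)%g. Proof. by []. Qed.

Lemma a0K : involutive a0.
Proof. by case=> t p; rewrite /a0 /= mulgA tperm2 mul1g. Qed.
Lemma a1K : involutive a1.
Proof. by case=> t p; rewrite /a1 /= mulgA tperm2 mul1g. Qed.
Lemma a2K : involutive a2.
Proof. by case=> t p; rewrite /a2 /= mulgA tperm2 mul1g. Qed.

Lemma a0_a2 f : a0 (a2 f) = a2 (a0 f).
Proof. by rewrite /a0 /a2 /= !mulgA s0s2C. Qed.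
Lemma a0_braid f : a0 (a1 (a0 f)) = a1 (a0 (a1 f)).
Proof. by rewrite /a0 /a1 /= !mulgA s0s1_braid. Qed.

Lemma a1_braid f : a1 (a2 (a1 f)) = a2 (a1 (a2 f)).
Proof. by rewrite /a1 /a2 /= !mulgA s1s2_braid. Qed.

Lemma sgn0 f : sgn (a0 f) = ~~ sgn f.
Proof. by rewrite /sgn odd_permM odd_tperm. Qed.
Lemma sgn1 f : sgn (a1 f) = ~~ sgn f.
Proof. by rewrite /sgn odd_permM odd_tperm. Qed.
Lemma sgn2 f : sgn (a2 f) = ~~ sgn f.
Proof. by rewrite /sgn odd_permM odd_tperm. Qed.

Lemma sgn_neq f h : sgn h = ~~ sgn f -> h != f.
Proof. by move=> e; apply/eqP => eh; move: e; rewrite eh; case: (sgn f). Qed.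

Lemma facet0 f : facet (a0 f) = facet f.
Proof. by rewrite /facet permM !permE. Qed.
Lemma facet1 f : facet (a1 f) = facet f.
Proof. by rewrite /facet permM !permE. Qed.
Lemma facet2 f : facet (a2 f) != facet f.
Proof. by rewrite /facet permM !permE /= xpair_eqE eqxx (inj_eq perm_inj). Qed.
Lemma corner1 f : corner (a1 f) = corner f.
Proof. by rewrite /corner permM !permE. Qed.
Lemma corner2 f : corner (a2 f) = corner f.
Proof. by rewrite /corner permM !permE. Qed.
Lemma corner0 f : corner (a0 f) != corner f.
Proof. by rewrite /corner permM !permE /= xpair_eqE eqxx (inj_eq perm_inj). Qed.
Lemma corner01 f : corner (a0 (a1 f)) != corner f.
Proof. by rewrite /corner !permM !permE /= ?permE /= xpair_eqE eqxx (inj_eq perm_inj). Qed.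
Lemma corner010 f : corner (a0 (a1 f)) != corner (a0 f).
Proof. by rewrite /corner !permM !permE /= ?permE /= xpair_eqE eqxx (inj_eq perm_inj). Qed.

Lemma same_facetE f h : same_facet f h = (facet f == facet h).
Proof. by rewrite /same_facet i3E xpair_eqE. Qed.

(** Two flags of one facet differ by a permutation fixing [o3], hence by a word in [s0] and [s1]. *)
Lemma facet_eq f h : facet h = facet f ->
  h \in [:: f; a0 f; a1 f; a0 (a1 f); a1 (a0 f); a0 (a1 (a0 f))].
Proof.
case: f h => [t p] [t' q] [-> e]; rewrite /a0 /a1 /=.
have -> : q = ((q * p^-1) * p)%g by rewrite mulgKV.
have := @perm4_fix3 (q * p^-1)%g; rewrite permM [q _]e permK => /(_ erefl).
move: (q * p^-1)%g => r.
rewrite !inE !xpair_eqE eqxx /=.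
by do 5?[case/orP => [/eqP->|]; first by rewrite ?mul1g ?mulgA eqxx ?orbT];
  move=> /eqP->; rewrite !mulgA eqxx ?orbT.
Qed.

Lemma facet_ind (P : flag -> Prop) f h :
  (forall x, P x -> P (a0 x)) -> (forall x, P x -> P (a1 x)) ->
  P f -> facet h = facet f -> P h.
Proof.
move=> P0 P1 Pf /facet_eq; rewrite !inE.
by do 5?[case/orP => [/eqP->|]]; try move=> /eqP ->; auto.
Qed.

Lemma tet_ind (P : flag -> Prop) f h :
  (forall x, P x -> P (a0 x)) -> (forall x, P x -> P (a1 x)) -> (forall x, P x -> P (a2 x)) ->
  P f -> h.1 = f.1 -> P h.
Proof.
move=> P0 P1 P2 Pf e1.
have [x [Px ex]] : exists x, P x /\ facet h = facet x.
  (* A facet is named by its opposite vertex: depending on the position in [f] of the vertex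
     opposite to the facet of [h], one of these words brings it to the last position. *)
  case: (ord4P (f.2^-1 (h.2 o3))%g) => /(congr1 f.2); rewrite permKV => e.
  - by exists (a2 (a1 (a0 f))); split; auto; rewrite /facet /= e1 e !permM !permE.
  - by exists (a2 (a1 f)); split; auto; rewrite /facet /= e1 e !permM !permE.
  - by exists (a2 f); split; auto; rewrite /facet /= e1 e !permM !permE.
  - by exists f; rewrite /facet e1 e.
exact: facet_ind P0 P1 Px ex.
Qed.

(** The six flags are told apart by their corners, and by their signs at equal corners. *)
Lemma card_facet f : #|[set h | facet h == facet f]| = 6.
Proof.
have -> : [set h | facet h == facet f] =
    [set h in [:: f; a0 f; a1 f; a0 (a1 f); a1 (a0 f); a0 (a1 (a0 f))]].
  apply/setP => h; rewrite !inE; apply/idP/idP => [/eqP/facet_eq|]; first by rewrite !inE.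
  by do 5?[case/orP => [/eqP->|]]; try move=> /eqP ->; rewrite ?(facet0, facet1).
rewrite cardsE; apply/eqP; change (#|[:: f; a0 f; a1 f; a0 (a1 f); a1 (a0 f);
  a0 (a1 (a0 f))]| == size [:: f; a0 f; a1 f; a0 (a1 f); a1 (a0 f); a0 (a1 (a0 f))]).
apply/eqP/card_uniqP.
have c (x y : flag) : corner x != corner y -> x != y by apply: contraNneq => ->.
have s (x y : flag) : sgn x != sgn y -> x != y by apply: contraNneq => ->.
rewrite /= !inE !negb_or !andbT.
have e1 : corner (a1 (a0 f)) = corner (a0 f) by rewrite corner1.
have e2 : corner (a0 (a1 (a0 f))) = corner (a0 (a1 f)) by rewrite a0_braid corner1.
have e3 : corner (a1 f) = corner f by rewrite corner1.
have n0 := corner0 f; have n1 := corner01 f; have n2 := corner010 f.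
rewrite ![_ == a0 f]eq_sym.
repeat (apply/andP; split); do ?[by apply: c; rewrite ?e1 ?e2 ?e3 // eq_sym];
  by apply: s; rewrite ?(sgn0, sgn1); case: (sgn f).
Qed.

(** * Cells of a glued complex as orbits of flags *)

Section Cells.
Variable g : {ffun flag -> flag}.
Implicit Types (ds : seq nat).

Lemma alphaE (k : 'I_4) f :
  alpha g k f = if k == 0 :> nat then a0 f else if k == 1 :> nat then a1 f
                else if k == 2 :> nat then a2 f else g f.
Proof.
have [i0 i1 i2 _] := inord4; have i3' := inord4.
rewrite /alpha i3E; case: (ord4P k) => -> /=; rewrite ?i0 ?i1 ?i2 //.
by case: i3' => _ _ _ ->.
Qed.

Lemma alpha0 f : alpha g ord0 f = a0 f. Proof. by rewrite alphaE. Qed.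
Lemma alpha1 f : alpha g (inord 1) f = a1 f. Proof. by rewrite alphaE inordK. Qed.

Lemma mem_cell ds f : f \in cell g ds f.
Proof. by rewrite inE connect0. Qed.

Lemma cell_ind (P : flag -> Prop) ds f :
  (0 \notin ds -> forall x, P x -> P (a0 x)) -> (1 \notin ds -> forall x, P x -> P (a1 x)) ->
  (2 \notin ds -> forall x, P x -> P (a2 x)) -> (3 \notin ds -> forall x, P x -> P (g x)) ->
  P f -> forall h, h \in cell g ds f -> P h.
Proof.
move=> P0 P1 P2 P3 Pf h; rewrite inE => /connectP [p pth ->] {h}.
elim: p f Pf pth => //= y p IH f Pf /andP [/existsP [k /andP [kds /eqP ey]] pth].
apply: IH pth; rewrite ey alphaE; case: (ord4P k) kds => -> /= kds; auto.
Qed.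

Lemma edge_end_ind (P : flag -> Prop) f :
  (forall x, P x -> P (a2 x)) -> (forall x, P x -> P (g x)) -> P f ->
  forall h, h \in edge_end g f -> P h.
Proof. by move=> P2 P3 Pf; apply: cell_ind. Qed.

Lemma vertex_ind (P : flag -> Prop) f :
  (forall x, P x -> P (a1 x)) -> (forall x, P x -> P (a2 x)) -> (forall x, P x -> P (g x)) ->
  P f -> forall h, h \in vertex g f -> P h.
Proof. by move=> P1 P2 P3 Pf; apply: cell_ind. Qed.

Lemma mem_cellS ds f h (k : 'I_4) : val k \notin ds -> h \in cell g ds f ->
  alpha g k h \in cell g ds f.
Proof.
rewrite !inE => kds fh; apply: connect_trans fh (connect1 _).
by apply/existsP; exists k; rewrite kds eqxx.
Qed.

Hypothesis gK : involutive g.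

Lemma alphaK k : involutive (alpha g k).
Proof.
by move=> f; rewrite !alphaE; case: (ord4P k) => -> /=; rewrite ?a0K ?a1K ?a2K ?gK.
Qed.

Lemma cell_sym ds f h : (h \in cell g ds f) = (f \in cell g ds h).
Proof.
rewrite !inE; apply: sym_connect_sym => {f h} u v.
by apply: eq_existsb => k; congr (_ && _); apply/eqP/eqP => ->; rewrite alphaK.
Qed.

Lemma cell_eq ds f h : h \in cell g ds f -> cell g ds h = cell g ds f.
Proof.
move=> hf; apply/setP => x; have fh := hf; rewrite cell_sym in fh.
by rewrite !inE in hf fh *; apply/idP/idP; apply: connect_trans.
Qed.

Lemma cell_eqE ds f h : (cell g ds h == cell g ds f) = (h \in cell g ds f).
Proof. by apply/eqP/idP => [<-|/cell_eq //]; apply: mem_cell. Qed.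

Lemma cellS ds (k : 'I_4) f : val k \notin ds -> cell g ds (alpha g k f) = cell g ds f.
Proof. by move=> kds; apply: cell_eq; apply: mem_cellS => //; apply: mem_cell. Qed.

Lemma cell0 ds f : 0 \notin ds -> cell g ds (a0 f) = cell g ds f.
Proof. by move=> k; rewrite -(@cellS ds o0 f k) alphaE. Qed.
Lemma cell1 ds f : 1 \notin ds -> cell g ds (a1 f) = cell g ds f.
Proof. by move=> k; rewrite -(@cellS ds o1 f k) alphaE. Qed.
Lemma cell2 ds f : 2 \notin ds -> cell g ds (a2 f) = cell g ds f.
Proof. by move=> k; rewrite -(@cellS ds o2 f k) alphaE. Qed.
Lemma cell3 ds f : 3 \notin ds -> cell g ds (g f) = cell g ds f.
Proof. by move=> k; rewrite -(@cellS ds o3 f k) alphaE. Qed.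

Lemma cell_sub ds ds' f : {subset ds' <= ds} -> cell g ds f \subset cell g ds' f.
Proof.
move=> s; apply/subsetP; have n k : k \notin ds -> k \notin ds' by apply: contra (s k).
apply: cell_ind; rewrite ?mem_cell // => /n k x; rewrite -!cell_eqE.
- by rewrite cell0.
- by rewrite cell1.
- by rewrite cell2.
- by rewrite cell3.
Qed.

Lemma cell_fold ds ds' f h : {subset ds' <= ds} -> h \in cell g ds f ->
  cell g ds' h = cell g ds' f.
Proof. by move=> s hf; apply: cell_eq; apply: (subsetP (cell_sub f s)). Qed.

Hypothesis g0 : forall f, g (a0 f) = a0 (g f).
Hypothesis g1 : forall f, g (a1 f) = a1 (g f).

(** As [a0] commutes with [a2] and [g], the orbit of an edge consists of one orbit around an end and
    its image by [a0]. *)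
Lemma edge_mem f h : (h \in edge g f) = (h \in edge_end g f) || (a0 h \in edge_end g f).
Proof.
apply/idP/idP; last first.
  have s : {subset edge_end g f <= edge g f}.
    by apply/subsetP/cell_sub => x; rewrite !inE => ->; rewrite orbT.
  by case/orP => /s //; rewrite /edge -!cell_eqE cell0.
move: h; apply: cell_ind => //= [_ x|_ x|_ x|]; rewrite ?mem_cell ?a0K //.
- by rewrite orbC.
- by rewrite a0_a2 -!cell_eqE !cell2.
- by rewrite -g0 -!cell_eqE !cell3.
Qed.

Lemma side_mem f h : (h \in side g f) = (h \in [:: f; g f; a0 f; a0 (g f)]).
Proof.
apply/idP/idP.
  move: h; apply: cell_ind => //=; rewrite ?inE ?eqxx //= => _ x; rewrite !inE;
    by case/or4P => /eqP->; rewrite ?g0 ?gK ?a0K eqxx ?orbT.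
by rewrite /side -cell_eqE !inE => /or4P [] /eqP->; rewrite ?cell0 ?cell3.
Qed.

Lemma triangle_mem f h :
  (h \in triangle g f) = (facet h == facet f) || (facet h == facet (g f)).
Proof.
apply/idP/idP.
  move: h; apply: cell_ind => // [_ x|_ x|_ x|]; rewrite ?facet0 ?facet1 ?eqxx //.
  have swap y : facet x = facet y -> facet (g x) = facet (g y).
    by apply: (@facet_ind (fun z => facet (g z) = facet (g y))) => // z;
      rewrite ?g0 ?g1 ?facet0 ?facet1.
  by case/orP => /eqP/swap ->; rewrite ?gK eqxx ?orbT.
rewrite /triangle -cell_eqE; have aux x y : facet x == facet y ->
  cell g [:: 2] x = cell g [:: 2] y.
  by move/eqP; apply: (@facet_ind (fun z => cell g [:: 2] z = cell g [:: 2] y)) => // z;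
    rewrite ?cell0 ?cell1.
case/orP => /aux h'; rewrite h' ?cell3 //.
Qed.

End Cells.
End Flags.

Arguments corner {tet} f.
Arguments facet {tet} f.
Arguments a0 {tet} f.
Arguments a1 {tet} f.
Arguments a2 {tet} f.

(** * Turning around an edge: the dihedral action on the flags of an edge end *)

Section Dihedral.
Variables (tet : finType) (g : {ffun flag tet -> flag tet}).
Notation flag := (flag tet).
Implicit Types (f h : flag).
Hypothesis gK : involutive g.

(** Rotation around the edge by one tetrahedron. Both reflections [a2] and [g] conjugate it to its
    inverse. *)
Let rho f := g (a2 f).

Lemma rho_inj : injective rho.
Proof. by move=> f h /(can_inj gK) /(can_inj (@a2K tet)). Qed.

Lemma rho_conj f : rho (a2 (rho f)) = a2 f.
Proof. by rewrite /rho a2K gK. Qed.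

Lemma fconnect_a2 f h : fconnect rho f h -> fconnect rho (a2 f) (a2 h).
Proof.
move/iter_findex => <-; elim: (findex _ _ _) => [|n IH]; first exact: connect0.
apply: connect_trans IH _; rewrite fconnect_sym; last exact: rho_inj.
by rewrite /= -[X in fconnect _ _ X]rho_conj; apply: fconnect1.
Qed.

Lemma edge_end_orbit f h :
  h \in edge_end g f -> fconnect rho f h || fconnect rho (a2 f) h.
Proof.
have st x : fconnect rho f x || fconnect rho (a2 f) x ->
    fconnect rho f (a2 x) || fconnect rho (a2 f) (a2 x).
  by case/orP => /fconnect_a2; rewrite ?a2K => ->; rewrite ?orbT.
move: h; apply: cell_ind => //= [_ x|]; last by rewrite connect0.
by move/st => /orP [] h; apply/orP; [left | right]; apply: connect_trans h _;
  rewrite -[X in g X]a2K; apply: fconnect1.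
Qed.

(** At a boundary flag, [rho (a2 f) = f], so the two orbits of [edge_end_orbit] merge into one. *)
Lemma edge_end_orbit_fixed f h : g f = f -> h \in edge_end g f -> fconnect rho f h.
Proof.
move=> gf /edge_end_orbit /orP [//|]; apply: connect_trans.
by rewrite fconnect_sym; [rewrite -{2}gf -{2}[f]a2K; apply: fconnect1 | exact: rho_inj].
Qed.

Lemma iter_rho_fixed i f : iter i rho (g (iter i rho f)) = g f.
Proof.
have rho_g x : rho (g (rho x)) = g x by rewrite /rho gK a2K.
by elim: i f => // i IH f; rewrite iterSr [X in g X]iterS rho_g IH.
Qed.

(** The reflection [g] fixes both [f] and [iter i rho f], so that [iter i.*2 rho f = f]; as [i] is
    positive and less than the order, the two boundary flags are half a turn apart. *)
Lemma fixed_orbit f h : g f = f -> g h = h -> fconnect rho f h -> h != f ->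
  (findex rho f h).*2 = fingraph.order rho f.
Proof.
move=> gf gh fh nh; have ih := iter_findex fh; have lt := findex_max fh.
move: (findex rho f h) ih lt => i ih lt.
have cyc : iter i.*2 rho f = f by rewrite -addnn iterD ih -{1}gh -{1}ih iter_rho_fixed.
have oi := iter_order rho_inj f.
have [le|] := leqP (fingraph.order rho f) i.*2.
  apply/eqP; rewrite eqn_leq le andbT -subn_eq0; apply/eqP.
  have e : iter (i.*2 - fingraph.order rho f) rho f = f.
    by rewrite -[X in iter _ _ X]oi -iterD subnK.
  have lt2 : i.*2 - fingraph.order rho f < fingraph.order rho f by lia.
  by have := findex_iter lt2; rewrite e findex0.
move=> lt2; have := findex_iter lt2; rewrite cyc findex0.
have : i != 0 by apply: contraNneq nh => e; rewrite -ih e.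
lia.
Qed.

Lemma fixed_unique f h h' : g f = f -> h \in edge_end g f -> g h = h -> h != f ->
  h' \in edge_end g f -> g h' = h' -> h' != f -> h' = h.
Proof.
move=> gf hf gh nh hf' gh' nh'.
have fh := edge_end_orbit_fixed gf hf; have fh' := edge_end_orbit_fixed gf hf'.
rewrite -(iter_findex fh) -(iter_findex fh'); congr (iter _ rho f).
by apply: double_inj; rewrite !fixed_orbit.
Qed.

(** [a2] pairs all the flags of the edge end and [g] those that it moves, so the number of boundary
    flags is even. *)
Lemma fixed_exists f : g f = f -> exists h, [/\ h \in edge_end g f, g h = h & h != f].
Proof.
move=> gf; have n2 x : a2 x != x by apply: sgn_neq; rewrite sgn2.
have e1 : ~~ odd #|edge_end g f|.
  apply: (@even_involution _ a2) => x xf; split=> //; last exact: a2K.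
  by move: xf; rewrite /edge_end -!(cell_eqE gK) cell2.
have e2 : ~~ odd #|edge_end g f :\: [set x | g x == x]|.
  apply: (@even_involution _ g) => x; rewrite !inE gK => /andP [gx xf]; split=> //.
  rewrite eq_sym gx; move: xf; have := @mem_cellS _ g [:: 0; 1] f x o3.
  by rewrite !inE alphaE => h /h ->.
have : ~~ odd #|edge_end g f :&: [set x | g x == x]|.
  by move: e1; rewrite -(cardsID [set x | g x == x]) oddD (negbTE e2) addbF.
rewrite (cardsD1 f) !inE gf eqxx connect0 add1n /= negbK => od.
have /card_gt0P [h] := odd_gt0 od; rewrite 2!inE in_setI inE => /and3P [nh hf /eqP gh].
by exists h; rewrite nh gh hf.
Qed.

(* For [f] on the boundary: the flag of the other boundary triangle at the same end
   of the same edge. *)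
Definition mate f := odflt f [pick h in edge_end g f | (g h == h) && (h != f)].

Lemma mateP f : g f = f -> [/\ mate f \in edge_end g f, g (mate f) = mate f & mate f != f].
Proof.
move=> gf; rewrite /mate; case: pickP => [h /and3P [-> /eqP -> ->] //|no].
have [h [h1 h2 h3]] := fixed_exists gf.
by have := no h; rewrite /= h1 h2 eqxx h3.
Qed.

Lemma mate_unique f h : g f = f -> h \in edge_end g f -> g h = h -> h = f \/ h = mate f.
Proof.
move=> gf hf gh; case: (eqVneq h f) => [|nh]; [by left | right].
by have [m1 m2 m3] := mateP gf; apply: fixed_unique hf gh nh.
Qed.

Lemma mateK f : g f = f -> mate (mate f) = f.
Proof.
move=> gf; have [m1 m2 m3] := mateP gf; have [n1 n2 n3] := mateP m2.
have n1' : mate (mate f) \in edge_end g f by rewrite /edge_end -(cell_eq gK m1).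
by case: (mate_unique gf n1' n2) => // e; rewrite e eqxx in n3.
Qed.

Lemma edge_end_a0 f h : (forall f, g (a0 f) = a0 (g f)) ->
  h \in edge_end g f -> a0 h \in edge_end g (a0 f).
Proof.
move=> g0; move: h; apply: cell_ind => // [_ x|_ x|]; last exact: mem_cell.
  by rewrite a0_a2 /edge_end -!(cell_eqE gK) cell2.
by rewrite -g0 /edge_end -!(cell_eqE gK) cell3.
Qed.

Lemma mate_a0 f : (forall f, g (a0 f) = a0 (g f)) -> g f = f -> mate (a0 f) = a0 (mate f).
Proof.
move=> g0 gf; have [m1 m2 m3] := mateP gf.
have gf' : g (a0 f) = a0 f by rewrite g0 gf.
case: (@mate_unique (a0 f) (a0 (mate f)) gf') => //; first exact: edge_end_a0.
  by rewrite g0 m2.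
by move/(can_inj (@a0K tet)) => e; rewrite e eqxx in m3.
Qed.

(** Signs rule out [a0 f] in the orbit of [f], since [rho] preserves them. If it were in the orbit
    of [a2 f], halfway between the two there would be a flag where [a0] agrees with [a2] or with
    [g]. *)
Lemma edge_nondegenerate f : (forall f, g (a0 f) = a0 (g f)) ->
  (forall f, facet (g f) != facet f) -> (forall f, sgn (g f) = ~~ sgn f) ->
  a0 f \notin edge_end g f.
Proof.
move=> g0 gn gs; apply/negP => /edge_end_orbit.
have rho_sgn i x : sgn (iter i rho x) = sgn x.
  by elim: i => //= i <-; rewrite /rho gs sgn2 negbK.
have key : forall i x, a0 x <> iter i rho (a2 x).
  fix IH 1 => -[|[|i]] x.
  - move=> /= e; have := facet0 x; rewrite e => /eqP; exact/negP/facet2.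
  - by rewrite /= /rho a2K => e; have := gn x; rewrite -e facet0 eqxx.
  (* Writing [x] as [rho y] and cancelling one turn at each end lowers the exponent by two. *)
  have -> : x = rho (a2 (g x)) by rewrite /rho a2K gK.
  set y := a2 (g x); rewrite iterSr iterS rho_conj [X in a0 X]/rho -g0 a0_a2 [X in _ <> X]/rho.
  by move/(can_inj gK)/(can_inj (@a2K tet)); apply: IH.
case/orP => /iter_findex e; last by have := key _ _ (esym e).
by have := sgn0 f; rewrite -e rho_sgn; case: (sgn f).
Qed.

End Dihedral.

#[local] Opaque cell a0 a1 a2.

(** * Cells of a closed triangulation [T], and of the complexes [G J] where only the triangles of
    [J] are glued *)

Section Triangulation.
Variables (tet : finType) (T : {ffun flag tet -> flag tet}).
Notation flag := (flag tet).
Implicit Types (f h : flag) (J : {set {set flag}}).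
Hypothesis hT : closed_triangulation T.
Notation G := (tree_of_tetrahedra T).
Notation tri := (triangle T).

Lemma TK : involutive T. Proof. exact: gluing_involutive hT. Qed.
Lemma T_a0 f : T (a0 f) = a0 (T f).
Proof. by have := gluing_simplicial hT (k := ord0) f isT; rewrite !alpha0. Qed.
Lemma T_a1 f : T (a1 f) = a1 (T f).
Proof. by have := gluing_simplicial hT (k := inord 1) f; rewrite !alpha1 => ->;
  rewrite ?inordK. Qed.
Lemma T_facet f : facet (T f) != facet f.
Proof. by rewrite -same_facetE; apply: gluing_facets. Qed.
Lemma T_sgn f : sgn (T f) = ~~ sgn f.
Proof. exact: gluing_oriented. Qed.
Lemma T_neq f : T f != f.
Proof. by apply: sgn_neq; rewrite T_sgn. Qed.

Lemma facet_T f h : facet h = facet f -> facet (T h) = facet (T f).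
Proof.
by apply: (@facet_ind tet (fun h => facet (T h) = facet (T f))) => // x;
  rewrite ?T_a0 ?T_a1 ?facet0 ?facet1.
Qed.

Lemma tri0 f : tri (a0 f) = tri f. Proof. by rewrite /triangle cell0 //; exact: TK. Qed.
Lemma tri1 f : tri (a1 f) = tri f. Proof. by rewrite /triangle cell1 //; exact: TK. Qed.
Lemma tri3 f : tri (T f) = tri f. Proof. by rewrite /triangle cell3 //; exact: TK. Qed.
Lemma tri_eqE f h : (tri h == tri f) = (facet h == facet f) || (facet h == facet (T f)).
Proof.
by rewrite /triangle (cell_eqE TK) -/(triangle T f) (triangle_mem TK T_a0 T_a1).
Qed.
Lemma tri_mem f h : (h \in tri f) = (tri h == tri f).
Proof. by rewrite /triangle (cell_eqE TK). Qed.

Lemma GE J f : G J f = if tri f \in J then T f else f.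
Proof. by rewrite ffunE. Qed.
Lemma GK J : involutive (G J).
Proof. by move=> f; rewrite !GE; case: (boolP (tri f \in J)) => fJ;
  rewrite ?tri3 ?fJ ?(negbTE fJ) ?TK. Qed.
Lemma G_a0 J f : G J (a0 f) = a0 (G J f).
Proof. by rewrite !GE tri0; case: ifP; rewrite ?T_a0. Qed.
Lemma G_a1 J f : G J (a1 f) = a1 (G J f).
Proof. by rewrite !GE tri1; case: ifP; rewrite ?T_a1. Qed.
Lemma G_fixed J f : (G J f == f) = (tri f \notin J).
Proof. by rewrite GE; case: (tri f \in J); rewrite ?eqxx ?(negbTE (T_neq f)). Qed.
Lemma G_fixedP J f : tri f \notin J -> G J f = f.
Proof. by rewrite -G_fixed => /eqP. Qed.
Lemma G_glued J f : tri f \in J -> G J f = T f.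
Proof. by rewrite GE => ->. Qed.

Lemma cellG_sub J ds f : cell (G J) ds f \subset cell T ds f.
Proof.
apply/subsetP; apply: cell_ind; rewrite ?mem_cell // => k x;
  rewrite -!(cell_eqE TK) ?(cell0 TK) ?(cell1 TK) ?(cell2 TK) //.
by rewrite GE; case: ifP; rewrite ?(cell3 TK).
Qed.

Lemma cellG_cell J ds f h : cell (G J) ds h = cell (G J) ds f -> cell T ds h = cell T ds f.
Proof. by move/eqP; rewrite (cell_eqE (GK J)) => /(subsetP (cellG_sub J ds f))/(cell_eq TK). Qed.

Lemma edge0 f : edge T (a0 f) = edge T f. Proof. by rewrite /edge (cell0 TK). Qed.
Lemma edge2 f : edge T (a2 f) = edge T f. Proof. by rewrite /edge (cell2 TK). Qed.
Lemma edge3 f : edge T (T f) = edge T f. Proof. by rewrite /edge (cell3 TK). Qed.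
Lemma edge_end3 f : edge_end T (T f) = edge_end T f. Proof. by rewrite /edge_end (cell3 TK). Qed.
Lemma edge_end_edge f h : h \in edge_end T f -> edge T h = edge T f.
Proof. by apply: (cell_fold TK) => x; rewrite !inE => ->; rewrite orbT. Qed.

Lemma a0_end f : a0 f \notin edge_end T f.
Proof. exact: edge_nondegenerate TK _ T_a0 T_facet T_sgn. Qed.

Lemma side_in f h : (h \in side T f) = (h \in [:: f; T f; a0 f; a0 (T f)]).
Proof. exact: (side_mem TK T_a0). Qed.

Lemma card_side f : #|side T f| = 4.
Proof.
rewrite (_ : #|_| = #|[:: f; T f; a0 f; a0 (T f)]|); last exact/eq_card/side_in.
apply/card_uniqP; rewrite /= !inE !negb_or !andbT.
have n (x y : flag) : facet x != facet y -> x != y by apply: contraNneq => ->.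
have nf := T_facet f; have n0 (x : flag) : x != a0 x by rewrite eq_sym sgn_neq ?sgn0.
by rewrite !n0 !n ?facet0 // eq_sym.
Qed.

Lemma corner_cell_in f h :
  (h \in cell T [:: 0; 2] f) = (h \in [:: f; T f; a1 f; a1 (T f)]).
Proof.
apply/idP/idP.
  move: h; apply: cell_ind => //=; rewrite ?inE ?eqxx //= => _ x; rewrite !inE;
    by case/or4P => /eqP->; rewrite ?T_a1 ?TK ?a1K eqxx ?orbT.
by rewrite -(cell_eqE TK) !inE => /or4P [] /eqP->; rewrite ?(cell1 TK) ?(cell3 TK).
Qed.

Lemma card_corner_cell f : #|cell T [:: 0; 2] f| = 4.
Proof.
rewrite (_ : #|_| = #|[:: f; T f; a1 f; a1 (T f)]|); last exact/eq_card/corner_cell_in.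
apply/card_uniqP; rewrite /= !inE !negb_or !andbT.
have n (x y : flag) : facet x != facet y -> x != y by apply: contraNneq => ->.
have nf := T_facet f; have n0 (x : flag) : x != a1 x by rewrite eq_sym sgn_neq ?sgn1.
by rewrite !n0 !n ?facet1 // eq_sym.
Qed.

Lemma side_end_in f h : (h \in cell T [:: 0; 1; 2] f) = (h \in [:: f; T f]).
Proof.
apply/idP/idP.
  move: h; apply: cell_ind => //=; rewrite ?inE ?eqxx //= => _ x; rewrite !inE;
    by case/orP => /eqP->; rewrite ?TK eqxx ?orbT.
by rewrite -(cell_eqE TK) !inE => /orP [] /eqP->; rewrite ?(cell3 TK).
Qed.

Lemma card_side_end f : #|cell T [:: 0; 1; 2] f| = 2.
Proof.
rewrite (_ : #|_| = #|[:: f; T f]|); last exact/eq_card/side_end_in.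
by apply/card_uniqP; rewrite /= !inE eq_sym T_neq.
Qed.

Lemma card_tri f : #|tri f| = 12.
Proof.
rewrite (_ : tri f = [set h | facet h == facet f] :|: [set h | facet h == facet (T f)]).
  rewrite cardsU !card_facet (_ : _ :&: _ = set0) ?cards0 //.
  apply/setP => h; rewrite !inE; apply/negP => /andP [/eqP->].
  by rewrite eq_sym; exact/negP/T_facet.
by apply/setP => h; rewrite (triangle_mem TK T_a0 T_a1) !inE.
Qed.

Lemma edge_same f h : edge T f = edge T h -> f \in edge_end T h \/ a0 f \in edge_end T h.
Proof.
by move/eqP; rewrite /edge (cell_eqE TK) (edge_mem TK T_a0) => /orP [] ->; [left | right].
Qed.

(* Both involutions [a2] and [T] are free of fixed points: were [T a] outside [W],
   [W] would be even by the former and odd by the latter. *)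
Lemma odd_crossing a (W : {set flag}) : (forall h, h \in W -> a2 h \in W) ->
  (forall h, h \in W -> h != a -> h != T a -> T h \in W) -> a \in W -> T a \in W.
Proof.
move=> W2 W3 aW; apply: contraT => TaW.
have n2 x : a2 x != x by apply: sgn_neq; rewrite sgn2.
have e1 : ~~ odd #|W|.
  by apply: (@even_involution _ a2) => x xW; rewrite W2 ?a2K.
have e2 : ~~ odd #|W :\ a|.
  apply: (@even_involution _ T) => x; rewrite !inE => /andP [nxa xW].
  rewrite W3 ?TK ?T_neq //; last by apply: contraNneq TaW => <-.
  by rewrite andbT; split=> //; apply: contraNneq TaW => <-; rewrite TK.
by move: e1; rewrite (cardsD1 a) aW oddD (negbTE e2).
Qed.

(** * Local constructions as orderings of the unglued triangles *)

Definition free J a := forall f, f \in edge_end T a -> tri f \notin J -> f = a \/ f = T a.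

(** That no other unglued side is left at this edge end is what makes the two copies of the triangle
    adjacent on the boundary along the edge. Forward, [odd_crossing] applies to the edge end in
    [G J]; backward, the only boundary flags of this edge end are [a] and [T a], so that it is
    already the whole edge end in [T]. *)
Lemma freeP J a : tri a \notin J -> free J a <-> T a \in edge_end (G J) a.
Proof.
move=> aJ; have sub := subsetP (cellG_sub J [:: 0; 1] a).
have W2 h : h \in edge_end (G J) a -> a2 h \in edge_end (G J) a.
  by rewrite /edge_end -!(cell_eqE (GK J)) (cell2 (GK J)).
have W3 h : h \in edge_end (G J) a -> G J h \in edge_end (G J) a.
  by rewrite /edge_end -!(cell_eqE (GK J)) (cell3 (GK J)).
split=> [fr|Ta].
  apply: (odd_crossing W2) => [h hW nha nhT|]; last exact: mem_cell.
  case: (boolP (tri h \in J)) => [/G_glued <-|hJ]; first exact: W3.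
  by have [e|e] := fr h (sub h hW) hJ; [rewrite e eqxx in nha | rewrite e eqxx in nhT].
have fx h : h \in edge_end (G J) a -> tri h \notin J -> h = a \/ h = T a.
  move=> hW hJ; have ga := G_fixedP aJ.
  have gTa : G J (T a) = T a by apply: G_fixedP; rewrite tri3.
  have [e|e] := mate_unique (GK J) ga Ta gTa; first by have := T_neq a; rewrite e eqxx.
  by rewrite e; apply: (mate_unique (GK J) ga hW (G_fixedP hJ)).
suff sub' : {subset edge_end T a <= edge_end (G J) a} by move=> f /sub'; apply: fx.
refine (@edge_end_ind _ T (fun f => f \in edge_end (G J) a) a W2 _ (mem_cell _ _ _)) => h hW.
case: (boolP (tri h \in J)) => [/G_glued <-|hJ]; first exact: W3.
by have [->|->] := fx h hW hJ; rewrite ?TK //; apply: mem_cell.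
Qed.

Lemma fold_G J a : tri a \notin J -> fold (G J) a (T a) = G (tri a |: J).
Proof.
move=> aJ; apply/ffunP => f; rewrite /fold ffunE [RHS]GE in_setU1 !same_facetE.
(* Commuting with [a0] and [a1], the gluing [T] acts on a whole facet by the formula of [fold]. *)
have key x h : facet h = facet x -> ((T x).1, h.2 * x.2^-1 * (T x).2)%g = T h.
  apply: (@facet_ind tet (fun h => ((T x).1, h.2 * x.2^-1 * (T x).2)%g = T h)).
  - by move=> y e; rewrite T_a0 -e !a0E /= !mulgA.
  - by move=> y e; rewrite T_a1 -e !a1E /= !mulgA.
  - by rewrite mulgV mul1g; case: (T x).
case: eqP => [e|/eqP n1]; first by rewrite (key a f e) tri_eqE e eqxx.
case: eqP => [e|/eqP n2]; last by rewrite tri_eqE (negbTE n1) (negbTE n2) GE.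
by have := key (T a) f e; rewrite TK => ->; rewrite tri_eqE e eqxx orbT.
Qed.

Definition simplicial (g : {ffun flag -> flag}) :=
  (forall f, g (a0 f) = a0 (g f)) /\ (forall f, g (a1 f) = a1 (g f)).

Lemma fold_simplicial g a b : simplicial g -> simplicial (fold g a b).
Proof.
case=> g0 g1; split=> f; rewrite /fold !ffunE !same_facetE ?facet0 ?facet1.
  by case: ifP => // _; rewrite ?g0; [|case: ifP => // _]; rewrite !a0E /= ?mulgA.
by case: ifP => // _; rewrite ?g1; [|case: ifP => // _]; rewrite !a1E /= ?mulgA.
Qed.

Lemma fold_moved g a b f : simplicial g -> can_fold g a b -> g f != f -> fold g a b f = g f.
Proof.
case=> g0 g1 /and4P [/eqP ga /eqP gb _ _] gf; rewrite /fold ffunE !same_facetE.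
have fx x : g x = x -> facet f = facet x -> g f = f.
  by apply: (@facet_ind tet (fun y => g y = y)) => y e; rewrite ?g0 ?g1 e.
case: eqP => [/(fx a ga) e|_]; first by rewrite e eqxx in gf.
by case: eqP => [/(fx b gb) e|_] //; rewrite e eqxx in gf.
Qed.

(** Gluings are never undone, as a step only changes facets still on the boundary. *)
Lemma construction_moved g w U f : simplicial g -> local_construction g w U ->
  g f != f -> U f = g f.
Proof.
elim: w g => [|[a b] w IH] g sg /= => [<- //|[cf lc] gf].
by rewrite -(fold_moved sg cf gf) (IH _ (fold_simplicial a b sg) lc) // (fold_moved sg cf gf).
Qed.

(** A local construction reduced to the first flags of its steps, the second ones being forced; [J]
    collects the triangles glued so far. *)
Fixpoint foldings J (s : seq flag) : Prop :=
  if s is a :: s' then [/\ tri a \notin J, free J a & foldings (tri a |: J) s']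
  else forall f, tri f \in J.

(** By [construction_moved] each step glues [a] to [T a], and the adjacency demanded by [can_fold]
    becomes [free]. *)
Lemma constructionP J w : local_construction (G J) w T <->
  exists2 s, w = [seq (a, T a) | a <- s] & foldings J s.
Proof.
split.
  elim: w J => [|[a b] w IH] J /=.
    move=> eT; exists [::] => //= f; rewrite -[_ \in _]negbK -G_fixed eT; exact: T_neq.
  case=> cf lc; have sG : simplicial (G J) by split; [apply: G_a0 | apply: G_a1].
  have /and4P [ga gb nab eab] := cf.
  have fab : fold (G J) a b a = b.
    by rewrite /fold ffunE same_facetE eqxx mulgV mul1g; case: (b).
  have eb : b = T a.
    rewrite (construction_moved (fold_simplicial a b sG) lc) fab //.
    by apply: contraNneq nab => ->; rewrite same_facetE.
  have aJ : tri a \notin J by rewrite -G_fixed.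
  move: lc eab; rewrite eb fold_G // => /IH [s -> fs] eab; exists (a :: s) => //.
  by split=> //; apply/(freeP aJ); rewrite /edge_end -(cell_eqE (GK J)) eq_sym.
case=> s -> {w}; elim: s J => [|a s IH] J /=.
  by move=> aJ; apply/ffunP => f; rewrite G_glued.
case=> aJ /(freeP aJ) fr /IH lc; rewrite fold_G //; split=> //.
rewrite /can_fold !G_fixed tri3 aJ same_facetE eq_sym T_facet /= eq_sym /edge_end.
by rewrite (cell_eqE (GK J)).
Qed.

Lemma foldings_notin J s a : foldings J s -> a \in s -> tri a \notin J.
Proof.
elim: s J => //= b s IH J [bJ _ /IH h]; rewrite inE => /orP [/eqP-> //|/h].
by rewrite in_setU1 negb_or => /andP [].
Qed.

Lemma free_edge J a f : free J a -> edge T f = edge T a -> tri f \notin J -> tri f = tri a.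
Proof.
move=> fr /edge_same [] h fJ; first by have [->|->] := fr f h fJ; rewrite ?tri3.
have := fr _ h; rewrite tri0 => /(_ fJ) e; rewrite -(tri0 f).
by case: e => ->; rewrite ?tri3.
Qed.

Lemma foldings_edge J s a b : free J a -> foldings (tri a |: J) s -> b \in s ->
  edge T b != edge T a.
Proof.
move=> fr fs /(foldings_notin fs); rewrite in_setU1 negb_or => /andP [nb bJ].
by apply: contraNneq nb => /(free_edge fr) ->.
Qed.

(** Each step glues one new triangle and folds along one new edge, since no unglued side is left at
    an edge once it has been folded. *)
Lemma foldings_card J s : foldings J s -> J \subset triangles T ->
  #|[set edge T a | a in s]| + #|J| = #|triangles T|.
Proof.
elim: s J => [|a s IH] J /=.
  move=> fs sJ; rewrite (_ : J = triangles T).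
    by rewrite (_ : [set _ | _ in _] = set0) ?cards0 //; apply/setP => x; rewrite inE;
      apply/negP => /imsetP [].
  by apply/eqP; rewrite eqEsubset sJ; apply/subsetP => _ /imsetP [f _ ->].
case=> aJ fr fs sJ; rewrite -(IH _ fs); last first.
  by rewrite subUset sJ sub1set andbT imset_f.
rewrite cardsU1 aJ (_ : [set edge T x | x in a :: s] = edge T a |: [set edge T x | x in s]).
  rewrite cardsU1 addnA; congr (_ + _); rewrite addnC; congr (_ + nat_of_bool _).
  by apply/negP => /imsetP [b bs e]; have := foldings_edge fr fs bs; rewrite e eqxx.
apply/setP => x; rewrite !inE; apply/imsetP/orP => [[b]|].
  by rewrite inE => /orP [/eqP-> ->|bs ->]; [left | right; apply: imset_f].
case=> [/eqP->|/imsetP [b bs ->]]; first by exists a; rewrite ?inE ?eqxx.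
by exists b; rewrite // inE bs orbT.
Qed.

(* Take the last gluing whose edge is in [D]. *)
Lemma foldings_last J s (D : {set {set flag}}) : foldings J s ->
  D \subset [set edge T a | a in s] -> D != set0 ->
  exists a, [/\ tri a \notin J, edge T a \in D,
    edge T (a1 a) \notin D & edge T (a1 (a0 a)) \notin D].
Proof.
elim: s J D => [|a s IH] J D /=.
  by move=> _ /subsetP s /set0Pn [e /s /imsetP []].
case=> aJ fr fs sD D0.
have [D'0|/set0Pn [e]] := eqVneq (D :\ edge T a) set0.
  have aD : edge T a \in D.
    case/set0Pn: D0 => e eD; have : e \notin D :\ edge T a by rewrite D'0 inE.
    by rewrite !inE eD andbT negbK => /eqP <-.
  (* By freeness, the other sides of the triangle do not lie on the edge of [a], the only edge of
     [D]. *)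
  have other b : tri b = tri a -> b != a -> b != T a -> a0 b != a -> a0 b != T a ->
      edge T b \notin D.
    move=> tb n1 n2 n3 n4; apply/negP => bD.
    have : edge T b \notin D :\ edge T a by rewrite D'0 inE.
    rewrite !inE bD andbT negbK => /eqP /edge_same [] /fr h.
      by have [e|e] := h (eq_ind_r (fun t => t \notin J) aJ tb); rewrite e eqxx in n1 n2.
    rewrite tri0 tb in h; have [e|e] := h aJ; by rewrite e eqxx in n3 n4.
  have nc (x y : flag) : corner x != corner y -> x != y by apply: contraNneq => ->.
  have ns (x y : flag) : sgn x != sgn y -> x != y by apply: contraNneq => ->.
  have nf (x : flag) : facet x = facet a -> x != T a.
    by move=> e; apply: contraNneq (T_facet a) => <-; rewrite e.
  exists a; split=> //; apply: other; rewrite ?tri1 ?tri0 //; try by apply: nf;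
    rewrite ?(facet0, facet1).
  - by apply: ns; rewrite sgn1; case: (sgn a).
  - by apply: nc; apply: corner01.
  - by apply: nc; rewrite corner1; apply: corner0.
  - by apply: nc; rewrite a0_braid corner1; apply: corner01.
rewrite !inE => /andP [nea eD].
have [||b [bJ bD b1 b2]] := IH _ (D :\ edge T a) fs.
- apply/subsetP => x; rewrite !inE => /andP [nx /(subsetP sD) /imsetP [b]].
  rewrite inE => /orP [/eqP-> ex|bs ->]; last exact: imset_f.
  by rewrite ex eqxx in nx.
- by apply/set0Pn; exists e; rewrite !inE nea.
move: bJ bD b1 b2; rewrite !inE !negb_or !negb_and !negbK => /andP [nb bJ] /andP [_ bD] b1 b2.
(* The edge removed from [D] is not a side of the triangle of [b], which is still unglued after the
   folding along that edge. *)
have n x : tri x = tri b -> edge T x != edge T a.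
  move=> tx; apply: contraNneq nb => /(free_edge fr); rewrite tx => <- //.
exists b; split=> //.
  by case/orP: b1 => // /eqP e1; have := n (a1 b); rewrite tri1 e1 eqxx => /(_ erefl).
by case/orP: b2 => // /eqP e1; have := n (a1 (a0 b)); rewrite tri1 tri0 e1 eqxx => /(_ erefl).
Qed.

(** * Edge markings along a construction, and what avoiding them means *)

Definition G_closed J (C : {set flag}) :=
  forall x, x \in C -> [/\ a0 x \in C, a2 x \in C & G J x \in C].

Lemma T_closed J (C : {set flag}) :
  (forall x, x \in C -> [/\ a0 x \in C, a2 x \in C & T x \in C]) -> G_closed J C.
Proof. by move=> cl x xC; have [h1 h2 h3] := cl x xC; rewrite GE; case: ifP. Qed.

Lemma G_closed_edge J C x h : G_closed J C -> edge (G J) h = edge (G J) x -> x \in C -> h \in C.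
Proof.
move=> cl e xC; have : h \in edge (G J) x by rewrite -e mem_cell.
move: h {e}; apply: (@cell_ind _ _ (fun h => h \in C)) => // _ h; by case/cl.
Qed.

Lemma mem_edge_imset J C h : G_closed J C -> (edge (G J) h \in edge (G J) @: C) = (h \in C).
Proof.
move=> cl; apply/imsetP/idP => [[x xC e]|hC]; last by exists h.
exact: G_closed_edge cl e xC.
Qed.

(** Marked edges are represented by the set [C] of their flags, which does not change when
    [edge_image] carries the marking to a more glued complex. *)
Lemma cover_edge_imset J C : G_closed J C -> cover (edge (G J) @: C) = C.
Proof.
move=> cl; apply/setP => h; apply/bigcupP/idP => [[_ /imsetP [x xC ->] hx]|hC].
  by apply: G_closed_edge cl _ xC; apply: (cell_eq (GK J)).
by exists (edge (G J) h); [apply: imset_f | apply: mem_cell].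
Qed.

Lemma foldings_avoid J s (C : {set flag}) :
  (forall x, x \in C -> [/\ a0 x \in C, a2 x \in C & T x \in C]) ->
  foldings J s -> (forall a, a \in s -> a \notin C) ->
  avoids (G J) [seq (a, T a) | a <- s] (edge (G J) @: C).
Proof.
move=> cl; elim: s J => //= a s IH J [aJ fr fs] nC.
have clT x : (T x \in C) = (x \in C).
  by apply/idP/idP => [/cl [_ _]|/cl [] //]; rewrite TK.
have clJ := T_closed J cl.
rewrite /other_edge1 /other_edge2 !alpha0 !alpha1 !mem_edge_imset // -T_a0 -!T_a1 !clT.
split=> //; first by apply: nC; rewrite inE eqxx.
rewrite fold_G // /edge_image cover_edge_imset //; apply: IH => // b bs.
by apply: nC; rewrite inE bs orbT.
Qed.

(** The folded edge is unmarked and the other two pairs of sides match, so [C] is closed under each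
    new gluing, and in the end under [T]. *)
Lemma avoid_closed J s (C : {set flag}) : G_closed J C -> foldings J s ->
  avoids (G J) [seq (a, T a) | a <- s] (edge (G J) @: C) ->
  (forall x, x \in C -> T x \in C) /\ (forall a, a \in s -> a \notin C).
Proof.
elim: s J => /= [|a s IH] J clJ.
  by move=> aJ _; split=> // x xC; have [_ _] := clJ x xC; rewrite G_glued.
case=> aJ fr fs; rewrite /other_edge1 /other_edge2 !alpha0 !alpha1 !mem_edge_imset //.
rewrite fold_G // /edge_image cover_edge_imset // => -[aC e1 e2 av].
have c0 x : (a0 x \in C) = (x \in C) by apply/idP/idP => /clJ [h _ _] //; rewrite a0K in h.
have TaC : T a \notin C.
  move/(freeP aJ): fr => Ta; apply: contra aC; apply: G_closed_edge clJ _.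
  by apply/esym/(cell_fold (GK J) _ Ta) => x; rewrite !inE => ->; rewrite orbT.
have cA x : facet x = facet a -> (T x \in C) = (x \in C).
  move/facet_eq; rewrite !inE.
  by do 5?[case/orP => [/eqP->|]]; try move=> /eqP ->;
    rewrite ?T_a0 ?T_a1 ?c0 ?(negbTE aC) ?(negbTE TaC) // ?T_a0 ?T_a1.
have cl' : G_closed (tri a |: J) C.
  move=> x xC; have [h0 h2 h3] := clJ x xC; split=> //.
  rewrite GE in_setU1; move: h3; rewrite GE; case: (boolP (tri x \in J)) => xJ;
    first by rewrite orbT.
  rewrite orbF; case: eqP => // /eqP; rewrite tri_eqE => /orP [] /eqP e _; first by rewrite cA.
  by rewrite -(cA (T x)) ?TK // (facet_T e) TK.
have [clT nC] := IH _ cl' fs av; split=> // b; rewrite inE => /orP [/eqP-> //|]; exact: nC.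
Qed.

(** * The tree of tetrahedra and its connected boundary *)

Section TreeOfTetrahedra.
Variable I : {set {set flag}}.
Hypothesis Isub : I \subset triangles T.
Hypothesis Itree : is_tree [set: tet] I (@dual_ends tet).
Notation T0 := (G I).
Notation dends := (@dual_ends tet).

Lemma dual_endsE f : dends (tri f) = [set f.1; (T f).1].
Proof.
apply/setP => t; apply/imsetP/idP => [[h]|].
  rewrite tri_mem tri_eqE !xpair_eqE => hf ->; case/orP: hf => /andP [/eqP -> _];
    by rewrite !inE eqxx ?orbT.
by rewrite !inE => /orP [] /eqP->; [exists f | exists (T f)]; rewrite // ?tri_mem ?tri3.
Qed.

Lemma dual_two_ended J : J \subset triangles T -> two_ended dends J.
Proof. by move=> /subsetP s k /s /imsetP [f _ ->]; exists f.1, (T f).1; apply: dual_endsE. Qed.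

(** The triangles selected by [P] form a forest in the dual graph; a leaf is a tetrahedron with a
    single selected facet. *)
Lemma internal_leaf (P : pred flag) f0 :
  (forall f, P f -> tri f \in I) -> (forall f, P (T f) = P f) -> P f0 ->
  exists f, [/\ P f & forall h, P h -> h.1 = f.1 -> facet h = facet f].
Proof.
move=> PI PT Pf0; pose es := tri @: [set f | P f].
have sI : es \subset I by apply/subsetP => k /imsetP [f]; rewrite inE => /PI fI ->.
have [||k [x [y [/imsetP [f]]]]] := acyclic_leaf _ (acyclicS sI (proj2 Itree)).
- exact: dual_two_ended (subset_trans sI Isub).
- by apply/set0Pn; exists (tri f0); apply: imset_f; rewrite inE.
rewrite inE => Pf -> ek xy leaf; rewrite dual_endsE in ek.
(* Choose the copy of the leaf triangle that lies in the leaf tetrahedron [x]. *)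
have [f' [Pf' f'x tf' Tf'x]] : exists f', [/\ P f', f'.1 = x, tri f' = tri f & (T f').1 <> x].
  have [fx|nfx] := eqVneq f.1 x.
    exists f; split=> // Tfx; move: ek; rewrite fx Tfx => /setP/(_ y).
    by rewrite !inE eqxx orbT orbb eq_sym (negbTE xy).
  exists (T f); rewrite PT tri3 TK; split=> //; last exact/eqP.
  by have : x \in [set f.1; (T f).1] by [rewrite ek !inE eqxx];
    rewrite !inE eq_sym (negbTE nfx) => /eqP.
exists f'; split=> // h Ph hx.
have : tri h = tri f'.
  by rewrite tf'; apply: leaf; [apply: imset_f;
    rewrite inE | rewrite dual_endsE !inE hx f'x eqxx].
move/eqP; rewrite tri_eqE => /orP [/eqP //|/eqP [e _]].
by case: Tf'x; rewrite -e hx.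
Qed.

(** If all the triangles met were internal, [internal_leaf] would give a tetrahedron met along a
    single facet, whereas [a2] leads to another one. *)
Lemma closed_has_boundary (O : pred flag) f0 : O f0 ->
  (forall f, O f -> O (a2 f)) -> (forall f, O f -> tri f \in I -> O (T f)) ->
  exists2 f, O f & tri f \notin I.
Proof.
move=> Of0 O2 O3.
case: (boolP [exists f, O f && (tri f \notin I)]) => [/existsP [f /andP []]|no];
  first by exists f.
have OI f : O f -> tri f \in I.
  by move=> Of; apply: contraT => fI; case/existsP: no; exists f; rewrite Of.
have OT f : O (T f) = O f.
  by apply/idP/idP => [Of|Of]; [rewrite -[f]TK|]; apply: O3; rewrite // OI.
have [f [Of h]] := internal_leaf OI OT Of0.
by have := facet2 f; rewrite h ?eqxx //; auto.
Qed.

(* [z] marks the edges of each tetrahedron; when three facets of a tetrahedron have a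
   constant marking, so has the fourth one, hence no tetrahedron is a leaf of the
   forest of the triangles with a non-constant marking. *)
Lemma boundary_connected (z : flag -> bool) :
  (forall f, z (a0 f) = z f) -> (forall f, z (a2 f) = z f) ->
  (forall f, tri f \in I -> z (T f) = z f) -> (forall f, tri f \notin I -> z (a1 f) = z f) ->
  forall f h, z f = z h.
Proof.
move=> z0 z2 z3 z1.
pose bad f := z (a1 f) != z f.
have badI f : bad f -> tri f \in I.
  by move=> bf; apply: contraT => /z1 e; rewrite /bad e eqxx in bf.
have badT f : bad (T f) = bad f.
  case: (boolP (tri f \in I)) => fI; first by rewrite /bad -T_a1 !z3 ?tri1.
  by rewrite /bad !z1 ?tri3 // !eqxx.
have z1' f : z (a1 f) = z f.
  apply/eqP; case: (boolP (bad f)) => [bf|]; last by rewrite negbK.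
  have [f' [bf' h]] := internal_leaf badI badT bf.
  have good x : x.1 = f'.1 -> facet x != facet f' -> z (a1 x) = z x.
    by move=> ex; apply: contraNeq => bx; rewrite h.
  have one1 x : (a1 x).1 = x.1 by rewrite a1E.
  have one2 x : (a2 x).1 = x.1 by rewrite a2E.
  (* By the braid relation, [a1] at [f'] is replaced with two uses of [a1] on other facets of the
     tetrahedron. *)
  case/eqP: bf'; have -> : a1 f' = a2 (a1 (a2 (a1 (a2 f')))) by rewrite -a1_braid a1K a2K.
  rewrite z2 good ?one1 ?one2 //; last by rewrite -a1_braid facet1 -[X in _ != X]facet1 facet2.
  by rewrite z2 good ?one2 // ?z2 // facet2.
have ztet f h : f.1 = h.1 -> z f = z h.
  by move=> e; refine (@tet_ind tet (fun x => z x = z h) h f _ _ _ _ e) => // x;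
    rewrite ?z0 ?z1' ?z2.
move=> f h; pose B := [set x.1 | x in [set x | z x == z f]].
have fB : f.1 \in B by apply: imset_f; rewrite inE.
have clB : ends_closed dends I B.
  move=> k x y kI ek /imsetP [u]; rewrite inE => /eqP zu xu.
  have /imsetP [v _ kv] := subsetP Isub k kI; move: kI ek; rewrite {}kv dual_endsE => vI ek.
  have yin : y \in [set v.1; (T v).1] by rewrite ek !inE eqxx orbT.
  have xin : x \in [set v.1; (T v).1] by rewrite ek !inE eqxx.
  have zv : z v == z f -> y \in B.
    move=> ev; move: yin; rewrite !inE => /orP [] /eqP->; apply: imset_f; rewrite inE // z3 //.
  by move: xin; rewrite !inE => /orP [] /eqP xv; apply: zv; rewrite -zu; apply/eqP;
    [|rewrite -(z3 _ vI)]; apply: ztet; rewrite -xv.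
have /subsetP/(_ h.1) := connected_closed (proj1 Itree) clB (in_setT f.1) fB.
by rewrite in_setT => /(_ isT) /imsetP [x]; rewrite inE => /eqP <- /ztet ->.
Qed.

End TreeOfTetrahedra.

(** * Counting flags, triangles, sides, vertices and edges *)

Section Counts.
Variables (I E : {set {set flag}}).
Notation T0 := (G I).
Notation dends := (@dual_ends tet).
Hypothesis Isub : I \subset triangles T.
Hypothesis Itree : is_tree [set: tet] I dends.

Definition Ext := [set f | external T I f].
Definition ExtE := [set f | external T I f && (edge T f \in E)].
Definition ExtN := [set f | external T I f && (edge T f \notin E)].
Notation n := #|ext_triangles T I|.
Notation k := #|Cut T I E|.
Notation m := #|edge T @: ExtN|.

Lemma external0 f : external T I (a0 f) = external T I f. Proof. by rewrite /external tri0. Qed.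
Lemma external1 f : external T I (a1 f) = external T I f. Proof. by rewrite /external tri1. Qed.
Lemma external3 f : external T I (T f) = external T I f. Proof. by rewrite /external tri3. Qed.

Lemma card_cells (D : {set flag}) ds c :
  (forall f h, f \in D -> h \in cell T ds f -> h \in D) ->
  (forall f, #|cell T ds f| = c) -> #|D| = c * #|cell T ds @: D|.
Proof.
move=> sat cc; apply: card_fibers => f fD; rewrite -(cc f); apply: eq_card => h.
rewrite inE (cell_eqE TK); apply/andP/idP => [[] //|hf]; split=> //; exact: sat hf.
Qed.

Lemma saturated (D : {set flag}) ds :
  (0 \notin ds -> forall x, x \in D -> a0 x \in D) -> (1 \notin ds -> forall x, x \in D ->
    a1 x \in D) ->
  (2 \notin ds -> forall x, x \in D -> a2 x \in D) -> (3 \notin ds -> forall x, x \in D ->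
    T x \in D) ->
  forall f h, f \in D -> h \in cell T ds f -> h \in D.
Proof. by move=> h0 h1 h2 h3 f h fD; apply: (@cell_ind _ _ (fun h => h \in D)). Qed.

Lemma card_Ext : #|Ext| = 12 * n.
Proof.
by apply: card_cells card_tri; apply: saturated => // _ x;
  rewrite !inE ?(external0, external1, external3).
Qed.

Lemma card_Int : #|~: Ext| = 12 * #|I|.
Proof.
have -> : I = tri @: (~: Ext).
  apply/setP => s; apply/idP/imsetP => [sI|[f]]; last by rewrite !inE negbK => fI ->.
  by have /imsetP [f _ es] := subsetP Isub s sI; exists f; rewrite // !inE /external -es sI.
by apply: card_cells card_tri; apply: saturated => // _ x;
  rewrite !inE ?(external0, external1, external3).
Qed.

Lemma card_tets : #|tet| = #|I|.+1.
Proof.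
rewrite -cardsT; apply: tree_card Itree; last by move=> *; apply: subsetT.
exact: (dual_two_ended Isub).
Qed.

(** There are 24 flags per tetrahedron and 12 per triangle, and [#|tet| - 1] internal triangles. *)
Lemma card_ext_triangles : n = #|tet|.+1.
Proof.
have := cardsC Ext; rewrite card_Ext card_Int card_prod card_Sn -[4`!]/24 card_tets; lia.
Qed.

Lemma card_ext_sides : #|ext_sides T I| = 3 * n.
Proof.
have : #|Ext| = 4 * #|ext_sides T I|.
  by apply: card_cells card_side; apply: saturated => // _ x;
    rewrite !inE ?(external0, external1, external3).
rewrite card_Ext; lia.
Qed.

Lemma card_ExtE : #|ExtE| = 4 * k.
Proof.
by apply: card_cells card_side; apply: saturated => // _ x;
  rewrite !inE ?external0 ?external3 ?edge0 ?edge3.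
Qed.

Lemma card_ExtEN : #|ExtE| + #|ExtN| = 12 * n.
Proof.
have -> : ExtE = Ext :&: [set f | edge T f \in E] by apply/setP => f; rewrite !inE.
have -> : ExtN = Ext :\: [set f | edge T f \in E] by apply/setP => f; rewrite !inE andbC.
by rewrite cardsID card_Ext.
Qed.

Lemma corner_vertex B x y :
  ends_closed (fun c : {set flag} => corner @: c) (cell T [:: 0; 2] @: ~: Ext) B ->
  y \in vertex T0 x -> corner x \in B -> corner y \in B.
Proof.
move=> clB yx xB; move: y yx.
apply: (@vertex_ind _ _ (fun y => corner y \in B)) => // f; rewrite ?corner1 ?corner2 //.
rewrite GE; case: ifP => // fI; apply: (clB (cell T [:: 0; 2] f)).
  by apply: imset_f; rewrite !inE /external fI.
apply/setP => c; rewrite !inE; apply/imsetP/orP => [[h]|].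
  by rewrite corner_cell_in !inE => /or4P [] /eqP-> ->; rewrite ?corner1 eqxx; auto.
by case=> /eqP->; [exists f | exists (T f)]; rewrite // corner_cell_in !inE eqxx ?orbT.
Qed.

(** The [4 #|tet|] corners of tetrahedra are identified through the [3 #|I|] corners of internal
    triangles, which leaves at least [#|I| + 4], that is [n + 2], vertices; all of them reach the
    boundary. *)
Lemma card_bd_vertices : n.+2 <= #|bd_vertices T0|.
Proof.
pose es := cell T [:: 0; 2] @: ~: Ext.
have ces : #|es| = 3 * #|I|.
  have : #|~: Ext| = 4 * #|es|.
    by apply: card_cells card_corner_cell; apply: saturated => // _ x;
      rewrite !inE ?(external1, external3).
  rewrite card_Int; lia.
have := @card_components _ _ (fun c : {set flag} =>
  corner @: c) _ _ corner (vertex T0) [set f | T0 f == f]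
  [set: tet * 'I_4] es.
rewrite cardsT card_prod card_ord ces card_ext_triangles card_tets => h.
suff : #|I|.+1 * 4 <= #|bd_vertices T0| + 3 * #|I| by lia.
apply: h => [B x y clB _ _ e|B clB sub].
  by apply: corner_vertex clB _; rewrite /vertex -(cell_eqE (GK I)) -/(vertex T0 x) -e.
apply/subsetP => -[t i] _.
pose f : flag := (t, tperm o0 i).
have -> : (t, i) = corner f by rewrite /corner tpermL.
have [|||h hf hI] := @closed_has_boundary I Isub Itree (mem (vertex T0 f)) f;
  rewrite /= ?mem_cell //.
- by move=> h; rewrite /vertex -!(cell_eqE (GK I)) (cell2 (GK I)).
- by move=> h + /G_glued <-; rewrite /vertex -!(cell_eqE (GK I)) (cell3 (GK I)).
apply: (@corner_vertex B h f clB); first by rewrite /vertex (cell_sym (GK I)).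
by apply: (subsetP sub); apply: imset_f; rewrite inE G_fixed.
Qed.

Lemma edge_has_boundary f : exists2 h, h \in edge_end T0 f & tri h \notin I.
Proof.
have [|||h hf hI] := @closed_has_boundary I Isub Itree (mem (edge_end T0 f)) f;
  rewrite /= ?mem_cell //.
- by move=> h; rewrite /edge_end -!(cell_eqE (GK I)) (cell2 (GK I)).
- by move=> h + /G_glued <-; rewrite /edge_end -!(cell_eqE (GK I)) (cell3 (GK I)).
by exists h.
Qed.

Lemma nonE_edges : edge T @: ExtN = edges T :\: E.
Proof.
apply/setP => e; rewrite in_setD; apply/imsetP/andP => [[f]|[eE /imsetP [f _ ef]]].
  by rewrite inE => /andP [_ fE] ->; rewrite fE imset_f.
have [h hf hI] := edge_has_boundary f.
have ehf := edge_end_edge (subsetP (cellG_sub I _ f) h hf).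
by exists h; rewrite ?inE /external ?hI ehf -?ef.
Qed.

(** A boundary edge carries at least four external flags: [f], its mate, and their images by [a0],
    which are distinct as edges are non-degenerate. *)
Lemma card_bd_edges (D : {set flag}) :
  (forall f h, f \in D -> external T I h -> h \in edge T0 f -> h \in D) ->
  (forall f, f \in D -> external T I f) -> 4 * #|edge T0 @: D| <= #|D|.
Proof.
move=> sat De; apply: card_fibers_ge => f fD.
have gf : T0 f = f by apply: G_fixedP; apply: De.
have [m1 m2 m3] := mateP (GK I) gf.
have n4 : a0 f \notin edge_end T0 f.
  by apply: contra (a0_end f); apply: (subsetP (cellG_sub I _ f)).
have em : edge_end T0 (mate T0 f) = edge_end T0 f by exact: cell_eq (GK I) _ _ _ m1.
have n5 : a0 (mate T0 f) \notin edge_end T0 f.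
  apply: contra (a0_end (mate T0 f)); rewrite -em; apply: (subsetP (cellG_sub I _ _)).
have emf : mate T0 f \in edge T0 f by rewrite (edge_mem (GK I) (G_a0 I)) m1.
have fx h : T0 h = h -> external T I h by move/eqP; rewrite G_fixed.
rewrite -[4]/(size [:: f; mate T0 f; a0 f; a0 (mate T0 f)]).
have /card_uniqP <- : uniq [:: f; mate T0 f; a0 f; a0 (mate T0 f)].
  rewrite /= !inE !negb_or (inj_eq (can_inj (@a0K tet))) ![_ == mate _ _]eq_sym !m3 !andbT.
  have nn x y : x \in edge_end T0 f -> y \notin edge_end T0 f -> x != y.
    by move=> hx hy; apply: contraNneq hy => <-.
  by rewrite !nn ?mem_cell //.
have ok h : T0 h = h -> h \in edge T0 f -> h \in [set y in D | edge T0 y == edge T0 f].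
  by move=> gh hf; rewrite inE (cell_eqE (GK I)) hf andbT; apply: sat hf => //; apply: fx.
apply: subset_leq_card; apply/subsetP => h; rewrite !in_cons in_nil orbF => /or4P [] /eqP->.
- by apply: ok => //; apply: mem_cell.
- exact: ok.
- by apply: ok; rewrite ?G_a0 ?gf // /edge -(cell_eqE (GK I)) (cell0 (GK I)).
- by apply: ok; rewrite ?G_a0 ?m2 // /edge -(cell_eqE (GK I)) (cell0 (GK I)) // (cell_eqE (GK I)).
Qed.

(** * Edges, vertices and incidence graph of T^{T_0}_E *)

Lemma cut_edgeE f : cut_edge T E f = if edge T f \in E then side T f else edge T f.
Proof. by []. Qed.

Lemma cut_edge_side f h : h \in side T f -> cut_edge T E h = cut_edge T E f.
Proof.
by rewrite side_in !inE !cut_edgeE => /or4P [] /eqP->;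
  rewrite ?edge0 ?edge3 ?edge0 ?edge3 // /side ?(cell0 TK) ?(cell3 TK) ?(cell0 TK).
Qed.

Lemma tri_side f h : h \in side T f -> tri h = tri f.
Proof. by rewrite side_in !inE => /or4P [] /eqP->; rewrite ?tri0 ?tri3. Qed.

Lemma card_cut_edges : #|cut_edges T I E| = m + k.
Proof.
have -> : cut_edges T I E = edge T @: ExtN :|: Cut T I E.
  apply/setP => c; rewrite inE; apply/imsetP/orP.
    case=> f; rewrite inE => ef ->; rewrite cut_edgeE; case: ifP => fE.
      by right; apply: imset_f; rewrite inE ef.
    by left; apply: imset_f; rewrite inE ef fE.
  by case=> /imsetP [f]; rewrite inE => /andP [ef fE] ->; exists f;
    rewrite ?inE // cut_edgeE ?fE // (negbTE fE).
rewrite cardsU (_ : _ :&: _ = set0) ?cards0 ?subn0 //.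
apply/setP => c; rewrite in_set0 inE; apply/negP => /andP [/imsetP [f + ->] /imsetP [h + e]].
rewrite !inE => /andP [_ fE] /andP [_ hE]; case/negP: fE.
have : f \in side T h by rewrite -e mem_cell.
by rewrite side_in !inE => /or4P [] /eqP->; rewrite ?edge0 ?edge3.
Qed.

Lemma card_incidence_vertices : #|incidence_vertices T I E| = n + (m + k).
Proof.
rewrite cardsU (_ : _ :&: _ = set0) ?cards0 ?subn0 ?(card_imset _ inl_inj) ?(card_imset _
  inr_inj).
  by rewrite card_cut_edges.
by apply/setP => x; rewrite !inE; apply/negP => /andP [/imsetP [y _ ->] /imsetP [z]].
Qed.

Lemma incidence_endsE f :
  incidence_ends T E (side T f) = [set inl (tri f); inr (cut_edge T E f)].
Proof.
apply/setP => x; rewrite !inE; apply/orP/orP.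
  by case=> /imsetP [h hf ->]; [left; rewrite (tri_side hf) | right; rewrite (cut_edge_side hf)].
by case=> /eqP->; [left | right]; apply: imset_f; apply: mem_cell.
Qed.

Lemma incidence_two_ended : two_ended (incidence_ends T E) (ext_sides T I).
Proof. by move=> _ /imsetP [f _ ->]; exists (inl (tri f)), (inr (cut_edge T E f));
  apply: incidence_endsE. Qed.

Lemma incidence_ends_sub s :
  s \in ext_sides T I -> incidence_ends T E s \subset incidence_vertices T I E.
Proof.
case/imsetP => f ef ->; rewrite incidence_endsE; apply/subsetP => x.
by rewrite !inE => /orP [] /eqP->; rewrite !imset_f ?orbT.
Qed.

Lemma tree_of_triangles_card : is_tree_of_triangles T I E -> m + k = (2 * n).+1.
Proof.
move/(tree_card incidence_two_ended incidence_ends_sub).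
rewrite card_incidence_vertices card_ext_sides; lia.
Qed.

Lemma attached_sym : symmetric (attached T I E).
Proof.
move=> f h; rewrite /attached !alpha1; case ef: (external T I f);
  case eh: (external T I h) => //=.
congr [|| _, _ | _].
- by apply/eqP/eqP => ->; rewrite a1K.
- by apply/eqP/eqP => ->; rewrite TK.
- apply/andP/andP => -[fE hf]; have e := edge_end_edge hf; split; rewrite -?e // ?e //;
    by rewrite /edge_end (cell_sym TK).
Qed.

Lemma cut_vertex_eq f h : h \in cut_vertex T I E f -> cut_vertex T I E h = cut_vertex T I E f.
Proof.
rewrite inE => hf; apply/setP => x; rewrite !inE.
by apply/esym/same_connect => //; apply: sym_connect_sym attached_sym.
Qed.

Lemma mem_cut_vertex f : f \in cut_vertex T I E f. Proof. by rewrite inE connect0. Qed.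

Lemma cut_vertex1 f : external T I f -> cut_vertex T I E (a1 f) = cut_vertex T I E f.
Proof.
move=> ef; apply: cut_vertex_eq; rewrite inE connect1 //.
by rewrite /attached alpha1 external1 ef eqxx.
Qed.

Lemma cut_vertex3 f : external T I f -> cut_vertex T I E (T f) = cut_vertex T I E f.
Proof.
move=> ef; apply: cut_vertex_eq; rewrite inE connect1 //.
by rewrite /attached external3 ef eqxx !orbT.
Qed.

Lemma cut_vertex_end f h : external T I f -> external T I h -> edge T f \notin E ->
  h \in edge_end T f -> cut_vertex T I E h = cut_vertex T I E f.
Proof.
move=> ef eh fE hf; apply: cut_vertex_eq; rewrite inE connect1 //.
by rewrite /attached ef eh fE hf !orbT.
Qed.

Lemma cut_vertex_ind (P : flag -> Prop) f :
  (forall x, external T I x -> P x -> P (a1 x)) -> (forall x, external T I x -> P x -> P (T x)) ->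
  (forall x y, external T I x -> external T I y -> edge T x \notin E -> y \in edge_end T x ->
    P x -> P y) ->
  P f -> forall h, h \in cut_vertex T I E f -> P h.
Proof.
move=> P1 P3 Pe Pf h; rewrite inE => /connectP [p pth ->] {h}.
elim: p f Pf pth => //= y p IH f Pf /andP [/and3P [ef ey at_fy] pth]; apply: IH pth.
by case/or3P: at_fy => [/eqP->|/eqP->|/andP [fE yf]]; rewrite ?alpha1;
  [apply: P1|apply: P3|apply: Pe Pf].
Qed.

Lemma cut_edge_endsE f : external T I f ->
  cut_edge_ends T I E (side T f) = [set cut_vertex T I E f; cut_vertex T I E (a0 f)].
Proof.
move=> ef; apply/setP => v; rewrite !inE; apply/imsetP/orP => [[h]|].
  by rewrite side_in !inE => /or4P [] /eqP-> ->; rewrite -?T_a0 ?cut_vertex3 ?external0 ?eqxx;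
    auto.
by case=> /eqP->; [exists f | exists (a0 f)]; rewrite // side_in !inE eqxx ?orbT.
Qed.

(* The vertices are the components of a graph between triangle corners and ends of
   edges not in [E]. *)
Lemma card_cut_vertices : 2 * (m + k) <= #|cut_vertices T I E| + 3 * n.
Proof.
pose cor := cell T [:: 0; 2]; pose se := cell T [:: 0; 1; 2] @: ExtN.
pose ends (c : {set flag}) : {set {set flag} + {set flag}} :=
  [set inl (cor f) | f in c] :|: [set inr (edge_end T f) | f in c].
have ccor : #|cor @: Ext| = 3 * n.
  have : #|Ext| = 4 * #|cor @: Ext|.
    by apply: card_cells card_corner_cell; apply: saturated => // _ x;
      rewrite !inE ?(external1, external3).
  rewrite card_Ext; lia.
(* External flags come by four on the sides of [Cut], and by two at each end of the other sides. *)
have cse : 4 * k + 2 * #|se| = 12 * n.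
  rewrite -card_ExtE -card_ExtEN; congr (_ + _); apply/esym.
  by apply: card_cells card_side_end; apply: saturated => // _ x; rewrite !inE external3 edge3.
(* By non-degeneracy, the two ends of an edge are distinct. *)
have cend : 2 * m <= #|edge_end T @: ExtN|.
  pose phi (c : {set flag}) := c :|: a0 @: c.
  have phiE f : phi (edge_end T f) = edge T f.
    apply/setP => h; rewrite in_setU (edge_mem TK T_a0); congr (_ || _).
    by apply/imsetP/idP => [[x xc ->]|hc]; [rewrite a0K | exists (a0 h); rewrite ?a0K].
  rewrite (_ : edge T @: ExtN = phi @: (edge_end T @: ExtN)); last first.
    by rewrite -imset_comp; apply: eq_imset => f; rewrite /= phiE.
  apply: card_fibers_ge => _ /imsetP [f fN ->].
  rewrite (_ : 2 = #|[set edge_end T f; edge_end T (a0 f)]|); last first.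
    by rewrite cards2 eq_sym (cell_eqE TK) a0_end.
  apply: subset_leq_card; apply/subsetP => c; rewrite !inE => /orP [] /eqP->.
    by rewrite imset_f ?eqxx.
  rewrite !phiE edge0 eqxx andbT; apply: imset_f.
  by move: fN; rewrite !inE external0 edge0.
have endsE f : ends (cell T [:: 0; 1; 2] f) = [set inl (cor f); inr (edge_end T f)].
  apply/setP => x; rewrite !inE; apply/orP/orP.
    case=> /imsetP [h]; rewrite side_end_in !inE => /orP [] /eqP-> ->;
      rewrite ?edge_end3 ?eqxx; auto.
    by left; rewrite /cor (cell3 TK).
  by case=> /eqP->; [left | right]; apply: imset_f; apply: mem_cell.
have hB B f : ends_closed ends se B -> f \in ExtN ->
    (inl (cor f) \in B) = (inr (edge_end T f) \in B).
  move=> clB fN; have fse : cell T [:: 0; 1; 2] f \in se by apply: imset_f.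
  by apply/idP/idP; apply: clB fse _; rewrite endsE // setUC.
pose vs := [set inl c | c in cor @: Ext] :|:
  [set inr c | c in edge_end T @: ExtN] : {set {set flag} + {set flag}}.
have cvs : #|vs| = 3 * n + #|edge_end T @: ExtN|.
  rewrite cardsU (_ : _ :&: _ = set0) ?cards0 ?subn0 ?(card_imset _ inl_inj) ?(card_imset _
    inr_inj) ?ccor //.
  by apply/setP => x; rewrite !inE; apply/negP => /andP [/imsetP [y _ ->] /imsetP [z]].
(* As [#|se|] equals [6 n - 2 k], this inequality and [cend] yield the bound. *)
suff : #|vs| <= #|cut_vertices T I E| + #|se| by rewrite cvs; lia.
apply: (@card_components _ _ ends _ _ (fun f => inl (cor f)) (cut_vertex T I E) Ext) =>
  [B x y clB|B clB sub].
  move=> xE _ e xB; have : y \in cut_vertex T I E x by rewrite -e mem_cut_vertex.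
  move: y {e}; apply: cut_vertex_ind => // [z _|z _|z y ez ey zE yz];
    rewrite /cor ?(cell1 TK) ?(cell3 TK) //.
  have zN : z \in ExtN by rewrite inE ez.
  have yN : y \in ExtN by rewrite inE ey (edge_end_edge yz).
  by rewrite !hB // /edge_end (cell_eq TK yz).
apply/subsetP => x; rewrite inE => /orP [] /imsetP [_ /imsetP [f fE ->] ->].
  by apply: (subsetP sub); apply: (imset_f (fun f => inl (cor f))).
rewrite -hB //; apply: (subsetP sub); apply: (imset_f (fun f => inl (cor f))).
by move: fE; rewrite !inE => /andP [].
Qed.

End Counts.

Lemma edge_endsE J f :
  edge_ends (G J) (edge (G J) f) = [set vertex (G J) f; vertex (G J) (a0 f)].
Proof.
apply/setP => v; rewrite !inE; apply/imsetP/orP => [[h]|].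
  rewrite (edge_mem (GK J) (G_a0 J)) => hf ->; case/orP: hf => hf; [left | right].
    by apply/eqP/(cell_fold (GK J) _ hf) => x; rewrite !inE => ->.
  have := edge_end_a0 (GK J) (G_a0 J) hf; rewrite a0K => {}hf.
  by apply/eqP/(cell_fold (GK J) _ hf) => x; rewrite !inE => ->.
by case=> /eqP->; [exists f | exists (a0 f)];
  rewrite ?mem_cell // /edge -(cell_eqE (GK J)) (cell0 (GK J)).
Qed.

(** The value of [u] at the third corner differs from its value at one of the two ends. *)
Lemma third_corner (u : flag -> bool) f :
  (forall x, facet x = facet f -> u (a1 x) = u x) -> u f != u (a0 f) ->
  u (a1 f) != u (a0 (a1 f)) \/ u (a1 (a0 f)) != u (a0 (a1 (a0 f))).
Proof.
move=> u1; have e1 : u (a0 (a1 (a0 f))) = u (a0 (a1 f)).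
  by rewrite a0_braid u1 // facet0 facet1.
rewrite e1 !u1 ?facet0 //.
by case: (u f); case: (u (a0 f)); case: (u _); auto.
Qed.

(** * Spreading an invariant marking over all external triangles *)

Section Spread.
Variables (I E : {set {set flag}}).
Notation T0 := (G I).
Notation dends := (@dual_ends tet).
Notation ext := (external T I).
Hypothesis Isub : I \subset triangles T.
Hypothesis Itree : is_tree [set: tet] I dends.

Lemma boundary_spread (z : flag -> bool) :
  (forall f, ext f -> z (a0 f) = z f) -> (forall f, ext f -> z (a1 f) = z f) ->
  (forall f, ext f -> z (mate T0 f) = z f) ->
  forall f h, ext f -> ext h -> z f = z h.
Proof.
move=> z0 z1 zm.
(* [y] extends the marking to all flags of the tree of tetrahedra by giving each edge end the common
   value at its boundary flags, as [boundary_connected] requires. *)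
pose y h := [exists x in edge_end T0 h, ext x && z x].
have yz f : ext f -> y f = z f.
  move=> ef; have gf := G_fixedP ef.
  apply/existsP/idP => [[x /and3P [xf ex zx]]|zf]; last by exists f; rewrite mem_cell ef.
  by have [<-|e] := mate_unique (GK I) gf xf (G_fixedP ex); rewrite // -zm // -e.
have y0' f : y f -> y (a0 f).
  case/existsP => x /and3P [xf ex zx]; apply/existsP; exists (a0 x).
  by rewrite (edge_end_a0 (GK I) (G_a0 I)) // z0 // zx external0 ex.
have y0 f : y (a0 f) = y f by apply/idP/idP => /y0'; rewrite ?a0K.
have y2 f : y (a2 f) = y f by rewrite /y /edge_end (cell2 (GK I)).
have y3 f : tri f \in I -> y (T f) = y f.
  by move=> fI; rewrite -(G_glued fI) /y /edge_end (cell3 (GK I)).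
have y1 f : tri f \notin I -> y (a1 f) = y f by move=> ef; rewrite !yz ?z1 // external1.
move=> f h ef eh; rewrite -!yz //; exact: (@boundary_connected I Isub Itree y y0 y2 y3 y1 f h).
Qed.

(** The triangles and cut edges where [z] holds form a closed set of vertices of the incidence
    graph. *)
Lemma incidence_spread (z : flag -> bool) :
  connected_graph (incidence_vertices T I E) (ext_sides T I) (incidence_ends T E) ->
  (forall f, ext f -> z (a0 f) = z f) -> (forall f, ext f -> z (a1 f) = z f) ->
  (forall f, ext f -> z (T f) = z f) ->
  (forall f h, ext f -> ext h -> edge T f \notin E -> h \in edge_end T f -> z h = z f) ->
  forall f h, ext f -> ext h -> z f = z h.
Proof.
move=> cn z0 z1 z3 ze.
suff imp f h : ext f -> ext h -> z f -> z h.
  by move=> f h ef eh; apply/idP/idP; apply: imp.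
move=> ef eh zf.
have ztri x y : ext x -> tri y = tri x -> z y = z x.
  move=> ex /eqP; rewrite tri_eqE.
  have aux t : ext t -> facet y = facet t -> z y = z t.
    move=> et e; suff [] : ext y /\ z y = z t by [].
    apply: (@facet_ind tet (fun y => ext y /\ z y = z t)) e => // s [es zs].
      by rewrite external0 z0.
    by rewrite external1 z1.
  by case/orP => /eqP /aux -> //; [rewrite z3 | rewrite external3].
have zcut x y : ext x -> ext y -> cut_edge T E y = cut_edge T E x -> z y = z x.
  move=> ex ey; rewrite !cut_edgeE; case: ifP => yE; case: ifP => xE.
  - move=> e; have : y \in side T x by rewrite -e mem_cell.
    by move/tri_side; apply: ztri.
  - by move=> e; have : x \in side T y by [rewrite e mem_cell];
    rewrite side_in !inE => /or4P [] /eqP xy;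
      move: xE; rewrite xy ?edge0 ?edge3 yE.
  - by move=> e; have : y \in side T x by [rewrite -e mem_cell];
    rewrite side_in !inE => /or4P [] /eqP xy;
      move: yE; rewrite xy ?edge0 ?edge3 xE.
  case/edge_same => hy; first by apply: ze; rewrite ?xE.
  by rewrite -(z0 y) //; apply: ze; rewrite ?external0 ?xE.
pose Z := [set x in Ext I | z x].
pose B : {set {set flag} + {set flag}} := [set inl (tri x) | x in Z] :|:
  [set inr (cut_edge T E x) | x in Z].
have inlB x : ext x -> (inl (tri x) \in B) = z x.
  move=> ex; rewrite inE; apply/orP/idP => [[/imsetP [y + [e]]|/imsetP [y _] //]|zx].
    by rewrite !inE => /andP [ey zy]; rewrite (ztri y x).
  by left; apply: imset_f; rewrite !inE ex.
have inrB x : ext x -> (inr (cut_edge T E x) \in B) = z x.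
  move=> ex; rewrite inE; apply/orP/idP => [[/imsetP [y _] //|/imsetP [y + [e]]]|zx].
    by rewrite !inE => /andP [ey zy]; rewrite (zcut y x).
  by right; apply: imset_f; rewrite !inE ex.
have clB : ends_closed (incidence_ends T E) (ext_sides T I) B.
  move=> s x y /imsetP [t + ->]; rewrite inE incidence_endsE => et es xB.
  have zt : z t.
    have : x \in [set inl (tri t); inr (cut_edge T E t)] by rewrite es !inE eqxx.
    by rewrite !inE => /orP [] /eqP ex; move: xB; rewrite ex ?inlB ?inrB //.
  have : y \in [set inl (tri t); inr (cut_edge T E t)] by rewrite es !inE eqxx orbT.
  by rewrite !in_set2 => /orP [] /eqP ->; rewrite ?inlB ?inrB.
have fv x : ext x -> inl (tri x) \in incidence_vertices T I E.
  by move=> ex; rewrite inE; apply/orP; left; do 2!apply: imset_f; rewrite inE.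
have := subsetP (connected_closed cn clB (fv f ef) _) (inl (tri h)).
by rewrite !inlB // => /(_ zf); apply; apply: fv.
Qed.

Lemma card_triangles : #|ext_triangles T I| + #|I| = #|triangles T|.
Proof.
have -> : ext_triangles T I = triangles T :\: I.
  apply/setP => t; rewrite inE; apply/imsetP/andP => [[f] + ->|[tI /imsetP [f _ e]]].
    by rewrite inE => ef; rewrite imset_f.
  by exists f; rewrite ?inE /external -?e.
by rewrite addnC -{1}(setIidPr Isub) cardsID.
Qed.

End Spread.

(** * From a tree-avoiding construction to a tree of triangles *)

Section Converse.
Variables (I E E0 : {set {set flag}}) (s : seq flag).
Notation T0 := (G I).
Notation dends := (@dual_ends tet).
Notation ext := (external T I).
Hypothesis Isub : I \subset triangles T.
Hypothesis Itree : is_tree [set: tet] I dends.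
Hypothesis hE : edge_spanning_tree T E.
Hypothesis hE0 : bd_spanning_tree T0 E0.
Hypothesis hs : foldings I s.
Hypothesis av : avoids T0 [seq (a, T a) | a <- s] E0.
Hypothesis crit : E = edges T :\: [set edge T a | a in s].

Let C := cover E0.

Let E0sub e : e \in E0 -> exists f, e = edge T0 f.
Proof. by move/(subsetP (proj1 hE0)) => /imsetP [f _ ->]; exists f. Qed.

Let Cclosed : G_closed I C.
Proof.
move=> x /bigcupP [e eE0 xe]; have [f ef] := E0sub eE0; rewrite ef in xe eE0.
suff h y : edge T0 y = edge T0 x -> y \in C.
  by split; apply: h; rewrite /edge ?(cell0 (GK I)) ?(cell2 (GK I)) ?(cell3 (GK I)).
move=> ey; apply/bigcupP; exists (edge T0 f) => //.
by rewrite /edge -(cell_eqE (GK I)) -/(edge T0 y) ey (cell_eqE (GK I)).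
Qed.

Let E0_C : E0 = edge T0 @: C.
Proof.
apply/setP => e; apply/idP/imsetP => [eE0|[x /bigcupP [e' eE0 xe'] ->]].
  have [f ef] := E0sub eE0; exists f => //; apply/bigcupP; exists e => //.
  by rewrite ef mem_cell.
have [f ef] := E0sub eE0; rewrite ef in xe' eE0.
by rewrite /edge (cell_eq (GK I) xe').
Qed.

Let CT : (forall x, x \in C -> T x \in C) /\ (forall a, a \in s -> a \notin C).
Proof. by apply: avoid_closed hs _ => //; rewrite -E0_C. Qed.

Let Cedge x y : edge T y = edge T x -> x \in C -> y \in C.
Proof.
move=> e xC; have : y \in edge T x by rewrite -e mem_cell.
apply: (@cell_ind _ _ (fun y => y \in C)) => // _ h hC; have [h0 h2 _] := Cclosed hC => //.
exact: (proj1 CT).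
Qed.

(** The image of [E0] avoids the folded edges, so it lies in [E]. Being the image of a connected
    spanning graph, it has at least as many edges as the tree [E]. *)
Let edgeC_E : edge T @: C = E.
Proof.
have sub : edge T @: C \subset E.
  apply/subsetP => _ /imsetP [x xC ->].
  have xT : edge T x \in edges T by apply: imset_f.
  rewrite crit inE xT andbT.
  apply/negP => /imsetP [a /(proj2 CT) aC e]; case/negP: aC; exact: Cedge (esym e) xC.
apply/eqP; rewrite eqEcard sub /= -ltnS.
(* Seeing [T] as the complex with all triangles glued gives access to [edge_endsE]. *)
have TE : G (triangles T) = T.
  by apply/ffunP => f; rewrite G_glued // imset_f.
have endsT f : edge_ends T (edge T f) = [set vertex T f; vertex T (a0 f)].
  by have := edge_endsE (triangles T) f; rewrite TE.
rewrite -(@tree_card _ _ (edge_ends T) (vertices T)); last exact: (proj2 hE).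
- apply: (@connected_card _ _ (edge_ends T)).
  have [t _] : exists t : tet, true.
    by have /andP [/set0Pn [t _] _] := proj1 Itree; exists t.
  apply: (@closed_connected _ _ _ _ _ (vertex T (t, 1%g))); first exact: imset_f.
  move=> B _ /imsetP [f _ ->] fB clB.
  have v0T x y : vertex T0 x = vertex T0 y -> vertex T x = vertex T y by apply: cellG_cell.
  have bd x : exists2 y, vertex T0 y = vertex T0 x & vertex T0 y \in bd_vertices T0.
    have [|||y hy yI] := @closed_has_boundary I Isub Itree [pred y | y \in vertex T0 x] x;
      rewrite /= ?mem_cell //.
    - by move=> h; rewrite /vertex -!(cell_eqE (GK I)) (cell2 (GK I)).
    - by move=> h + /G_glued <-; rewrite /vertex -!(cell_eqE (GK I)) (cell3 (GK I)).
    exists y; first exact: (cell_eq (GK I)).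
    by apply: imset_f; rewrite inE G_fixed.
  (* Vertices of the tree of tetrahedra lying over [B]. *)
  pose B0 := [set v : {set flag} | [exists x in v, vertex T x \in B]].
  have B0P (v : {set flag}) : reflect (exists2 x, x \in v & vertex T x \in B) (v \in B0).
    by rewrite in_set; apply: exists_inP.
  have inB0 x : (vertex T0 x \in B0) = (vertex T x \in B).
    apply/B0P/idP => [[y yx yB]|xB]; last by exists x; first exact: mem_cell.
    have exy : vertex T0 y = vertex T0 x by exact: (cell_eq (GK I) yx).
    by rewrite -(v0T _ _ exy).
  have clB0 : ends_closed (edge_ends T0) E0 B0.
    move=> e v v' eE0; have [x ex] := E0sub eE0; rewrite {e}ex in eE0 *;
      rewrite edge_endsE => ev vB.
    have xC : x \in C by apply/bigcupP; exists (edge T0 x); rewrite ?mem_cell.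
    have both y : edge T y = edge T x -> (vertex T y \in B) -> (vertex T (a0 y) \in B).
      move=> ey; apply: (clB (edge T x)); first exact: imset_f.
      by rewrite -ey endsT.
    have ux : vertex T x \in B -> vertex T (a0 x) \in B by apply: both.
    have ux' : vertex T (a0 x) \in B -> vertex T x \in B.
      by have := both (a0 x); rewrite a0K => h; apply: h; apply: edge0.
    have [ex|ex] : v = vertex T0 x \/ v = vertex T0 (a0 x) by apply/set2P; rewrite ev set21.
      have xB : vertex T x \in B by rewrite -inB0 -ex.
      have [->|->] : v' = vertex T0 x \/ v' = vertex T0 (a0 x) by apply/set2P; rewrite ev set22.
        by rewrite inB0.
      by rewrite inB0; apply: ux.
    have xB : vertex T (a0 x) \in B by rewrite -inB0 -ex.
    have [->|->] : v' = vertex T0 x \/ v' = vertex T0 (a0 x) by apply/set2P; rewrite ev set22.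
      by rewrite inB0; apply: ux'.
    by rewrite inB0.
  apply/subsetP => _ /imsetP [h _ ->].
  have [f' ef f'v] := bd f; have [h' eh h'v] := bd h.
  have f'B : vertex T0 f' \in B0 by rewrite ef inB0.
  have := subsetP (connected_closed (proj1 (proj2 hE0)) clB0 f'v f'B) _ h'v.
  by move=> h'B; rewrite -inB0 -eh.
- by move=> e /(subsetP (proj1 hE)) /imsetP [f _ ->]; exists (vertex T f), (vertex T (a0 f));
  apply: endsT.
move=> e /(subsetP (proj1 hE)) /imsetP [f _ ->]; rewrite endsT; apply/subsetP => v.
by case/set2P => ->; apply: imset_f.
Qed.

Let inC f : (f \in C) = (edge T f \in E).
Proof.
apply/idP/idP => [fC|]; first by rewrite -edgeC_E imset_f.
by rewrite -edgeC_E => /imsetP [x xC e]; apply: Cedge e xC.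
Qed.

Let inE0 f : (edge T0 f \in E0) = (edge T f \in E).
Proof.
have h := mem_edge_imset f Cclosed; rewrite -E0_C in h.
exact: etrans h (inC f).
Qed.

(** For a closed set [B], the boundary edges across which membership of triangles in [B] changes
    belong to the forest [E0]; a leaf vertex for these edges would see an odd number of changes
    around it. So there is no change, and the boundary is connected. *)
Lemma incidence_connected :
  connected_graph (incidence_vertices T I E) (ext_sides T I) (incidence_ends T E).
Proof.
have [t _] : exists t : tet, true.
  by have /andP [/set0Pn [t _] _] := proj1 Itree; exists t.
have [f0 _ ef0] := edge_has_boundary Isub Itree (t, 1%g).
apply: (@closed_connected _ _ _ _ _ (inl (tri f0))).
  by rewrite inE; apply/orP; left; do 2!apply: imset_f; rewrite inE.
move=> B x0 x0v x0B clB.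
pose z f := inl (tri f) \in B.
have zc f : ext f -> z f = (inr (cut_edge T E f) \in B).
  move=> ef; have sf : side T f \in ext_sides T I by apply: imset_f; rewrite inE.
  by apply/idP/idP; apply: clB sf _; rewrite incidence_endsE // setUC.
have z0 f : z (a0 f) = z f by rewrite /z tri0.
have z1 f : z (a1 f) = z f by rewrite /z tri1.
have zN f h : ext f -> ext h -> edge T f \notin E -> edge T h = edge T f -> z f = z h.
  by move=> ef eh fE e; rewrite !zc // !cut_edgeE e (negbTE fE).
have fx f : ext f -> T0 f = f by apply: G_fixedP.
have em f : ext f -> ext (mate T0 f).
  by move=> ef; have [_ + _] := mateP (GK I) (fx f ef); move/eqP; rewrite G_fixed.
have zm f : ext f -> z (mate T0 f) = z f.
  move=> ef; apply/eqP; apply: contraT => bad.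
  pose D := edge T0 @: [set f | ext f && (z (mate T0 f) != z f)].
  have mend x : ext x -> mate T0 x \in edge_end T0 x by move=> ex;
    have [] := mateP (GK I) (fx x ex).
  have DE : D \subset E0.
    apply/subsetP => _ /imsetP [x + ->]; rewrite inE inE0 => /andP [ex nz];
      apply: contraNT nz => xE.
    rewrite eq_sym; apply/eqP/zN => //; first exact: em.
    by apply: edge_end_edge; apply: (subsetP (cellG_sub I _ x)); apply: mend.
  have [||e [v [v' [/imsetP [x]]]]] := acyclic_leaf _ (acyclicS DE (proj2 (proj2 hE0))).
  - move=> _ /imsetP [x _ ->]; exists (vertex T0 x), (vertex T0 (a0 x)); exact: edge_endsE.
  - by apply/set0Pn; exists (edge T0 f); apply: imset_f; rewrite inE ef.
  rewrite inE => /andP [ex badx] -> ends vv' leaf.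
  have m0 y : ext y -> mate T0 (a0 y) = a0 (mate T0 y).
    by move=> ey; apply: (mate_a0 (GK I) (G_a0 I)); apply: fx.
  have mv y : ext y -> vertex T0 (mate T0 y) = vertex T0 y.
    by move=> ey; apply: (cell_fold (GK I) _ (mend y ey)) => i; rewrite !inE => ->.
  have [q [[eq' eqx qv q'v] badq]] : exists y, [/\ ext y, edge T0 y = edge T0 x, vertex T0 y = v
      & vertex T0 (a0 y) = v'] /\ z (mate T0 y) != z y.
    have vx : v = vertex T0 x \/ v = vertex T0 (a0 x).
      by apply/set2P; rewrite -edge_endsE ends set21.
    have vx' : v' = vertex T0 x \/ v' = vertex T0 (a0 x).
      by apply/set2P; rewrite -edge_endsE ends set22.
    case: vx vx' => [e1|e1] [e2|e2]; try by move: vv'; rewrite e1 e2 eqxx.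
      by exists x.
    exists (a0 x); rewrite external0 a0K m0 // !z0; split=> //; split=> //.
    by rewrite /edge (cell0 (GK I)).
  (* Among the boundary flags of this edge at the leaf [v], choose the marked one. *)
  have [y [[ey eyx yv y'v] zy zmy]] : exists y, [/\ [/\ ext y, edge T0 y = edge T0 x,
      vertex T0 y = v & vertex T0 (a0 y) = v'], z y & ~~ z (mate T0 y)].
    case zq: (z q).
      by exists q; split=> //; move: badq; rewrite zq; case: (z _).
    exists (mate T0 q); rewrite (mateK (GK I) (fx q eq')) zq; split=> //; last first.
      by move: badq; rewrite zq; case: (z _).
    split; [exact: em | | by rewrite mv | by rewrite -m0 // mv // external0].
    rewrite -eqx; apply: (cell_fold (GK I) _ (mend q eq')) => i.
    by rewrite !inE => ->; rewrite orbT.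
  (* Marked boundary flags at [v]: [a1] pairs them all, while [mate] pairs all of them but [y],
     since [y] is on the only edge at [v] where the marking changes. *)
  pose S := [set h | [&& ext h, vertex T0 h == v & z h]].
  have n1 h : a1 h != h by apply: sgn_neq; rewrite sgn1.
  have evS : ~~ odd #|S|.
    apply: (@even_involution _ a1) => h; rewrite !inE external1 z1 a1K => /and3P [-> /eqP <- ->].
    by rewrite /vertex (cell1 (GK I)) // eqxx.
  have evS' : ~~ odd #|S :\ y|.
    apply: (@even_involution _ (mate T0)) => h;
      rewrite !inE => /andP [nhy /and3P [eh /eqP hv zh]].
    have [_ _ nm] := mateP (GK I) (fx h eh).
    have mm : mate T0 (mate T0 h) = h by apply: mateK (GK I) _ (fx h eh).
    split=> //; apply/and4P; split; [|exact: em|by rewrite mv // hv|].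
      by apply: contraNneq zmy => <-; rewrite mm.
    apply: contraT => zmh.
    have hD : edge T0 h \in D by apply: imset_f; rewrite inE eh zh (negbTE zmh).
    have ehy : edge T0 h = edge T0 y.
      by rewrite eyx; apply: (leaf _ hD); rewrite edge_endsE hv; apply: set21.
    have : h \in edge T0 y by rewrite -ehy mem_cell.
    rewrite (edge_mem (GK I) (G_a0 I)) => /orP [] he.
      case: (mate_unique (GK I) (fx y ey) he (fx h eh)) => eh'; first by rewrite eh' eqxx in nhy.
      by move: zh; rewrite eh' (negbTE zmy).
    have he' := edge_end_a0 (GK I) (G_a0 I) he; rewrite a0K in he'.
    case/eqP: vv'; rewrite -hv -y'v.
    by apply: (cell_fold (GK I) _ he') => i; rewrite !inE => ->.
  by move: evS; rewrite (cardsD1 y) !inE ey yv eqxx zy /= (negbTE evS').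
have same := boundary_spread Isub Itree (fun f _ => z0 f) (fun f _ => z1 f) zm.
have zall f : ext f -> z f.
  move=> ef; move: x0v x0B; rewrite inE => /orP [] /imsetP [_ /imsetP [h + ->] ->];
    rewrite inE => eh.
    by move=> zh; rewrite (same f h).
  by rewrite -zc // => zh; rewrite (same f h).
apply/subsetP => x; rewrite inE => /orP [] /imsetP [_ /imsetP [h + ->] ->]; rewrite inE => eh.
  exact: zall.
by rewrite -zc //; apply: zall.
Qed.

Lemma card_nonE : #|edge T @: ExtN I E| = #|ext_triangles T I|.
Proof.
have -> : edge T @: ExtN I E = [set edge T a | a in s].
  rewrite (nonE_edges E Isub Itree) {1}crit setDDr setDv set0U; apply/setIidPr.
  by apply/subsetP => _ /imsetP [a _ ->]; apply: imset_f.
have := foldings_card hs Isub; have := card_triangles Isub; lia.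
Qed.

(** [E0] connects at least [n + 2] vertices, hence has at least [n + 1] edges, and each takes at
    least four of the [4 k] flags of [ExtE]. *)
Lemma card_Cut_ge : #|ext_triangles T I| < #|Cut T I E|.
Proof.
have cE0 : #|E0| <= #|Cut T I E|.
  have -> : E0 = edge T0 @: ExtE I E.
    apply/setP => e; apply/idP/imsetP => [eE0|[f]]; last by rewrite inE -inE0 => /andP [_ fE ->].
    have [f ef] := E0sub eE0; have [h hf hI] := edge_has_boundary Isub Itree f.
    have ehf : edge T0 h = edge T0 f.
      by apply: (cell_fold (GK I) _ hf) => i; rewrite !inE => ->; rewrite orbT.
    by exists h; rewrite ?ehf // inE /external hI -inE0 ehf -ef.
  have sat f h : f \in ExtE I E -> ext h -> h \in edge T0 f -> h \in ExtE I E.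
    move=> fEE eh hf; have fE : edge T f \in E by move: fEE; rewrite inE => /andP [].
    rewrite inE eh; have -> : edge T h = edge T f by exact: (cellG_cell (cell_eq (GK I) hf)).
    exact: fE.
  have Eext f : f \in ExtE I E -> ext f by rewrite inE => /andP [].
  by have := card_bd_edges sat Eext; rewrite card_ExtE leq_pmul2l.
have := connected_card (proj1 (proj2 hE0)); have := card_bd_vertices Isub Itree; lia.
Qed.

Lemma in_TT_converse : in_TT T I E.
Proof.
have tr : is_tree_of_triangles T I E.
  apply: connected_tree incidence_connected _;
    rewrite card_incidence_vertices (card_ext_sides Isub) card_nonE.
  have := card_Cut_ge; lia.
split=> //; apply: connected_tree; last first.
  (* With [m = n] and [m + k = 2 n + 1], there are at least [n + 2] vertices, one more than [k]. *)
  have := card_cut_vertices E Isub; have := tree_of_triangles_card Isub tr; rewrite card_nonE;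
    lia.
have [t _] : exists t : tet, true.
  by have /andP [/set0Pn [t _] _] := proj1 Itree; exists t.
have [f0 _ ef0] := edge_has_boundary Isub Itree (t, 1%g).
apply: (@closed_connected _ _ _ _ _ (cut_vertex T I E f0)); first by apply: imset_f; rewrite inE.
move=> B _ /imsetP [f1 + ->]; rewrite inE => ef1 f1B clB.
pose u f := cut_vertex T I E f \in B.
have u1 f : ext f -> u (a1 f) = u f by move=> ef; rewrite /u cut_vertex1.
have u3 f : ext f -> u (T f) = u f by move=> ef; rewrite /u cut_vertex3.
have ue f h : ext f -> ext h -> edge T f \notin E -> h \in edge_end T f -> u h = u f.
  by move=> ef eh fE hf; rewrite /u (cut_vertex_end ef eh fE hf).
have uE f : ext f -> edge T f \in E -> u (a0 f) = u f.
  move=> ef fE; have sC : side T f \in Cut T I E by apply: imset_f; rewrite inE ef.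
  by apply/idP/idP; apply: clB sC _; rewrite cut_edge_endsE // setUC.
have u0 f : ext f -> u (a0 f) = u f.
  move=> ef; apply/eqP; apply: contraT => bad.
  (* Edges with a single end in [B]. By [foldings_last], some triangle has exactly one side along
     them, against [third_corner]. *)
  pose D := edge T @: [set f in ExtN I E | u (a0 f) != u f].
  have inD x : ext x -> u x != u (a0 x) -> edge T x \in D.
    move=> ex ux; apply: imset_f; rewrite !inE ex eq_sym ux andbT /=.
    by apply: contraNN ux => xE; rewrite uE.
  have [||a [aI + n1 n2]] := foldings_last (D := D) hs.
  - apply/subsetP => _ /imsetP [x + ->]; rewrite !inE => /andP [/andP [_ xE] _].
    have xT : edge T x \in edges T by apply: imset_f.
    by move: xE; rewrite crit inE xT andbT negbK.
  - by apply/set0Pn; exists (edge T f); apply: inD => //; rewrite eq_sym.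
  case/imsetP => h; rewrite !inE => /andP [/andP [eh hE'] uh] eah.
  have aN : edge T a \notin E by rewrite eah.
  have ua : u a != u (a0 a).
    have [ha|ha] := edge_same (esym eah).
      have ha' : a0 h \in edge_end T (a0 a) by exact: (edge_end_a0 TK T_a0 ha).
      by rewrite -(ue a h) // -(ue (a0 a) (a0 h)) ?external0 ?edge0 // eq_sym.
    have ha' : h \in edge_end T (a0 a) by rewrite -[h]a0K; exact: (edge_end_a0 TK T_a0 ha).
    by rewrite -(ue a (a0 h)) ?external0 // -(ue (a0 a) h) ?external0 ?edge0.
  have ext_facet x : facet x = facet a -> ext x.
    by apply: (@facet_ind tet (fun x => ext x)) => // y; rewrite ?external0 ?external1.
  have [|ub|ub] := third_corner _ ua; first by move=> x /ext_facet; apply: u1.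
    by move: n1; rewrite inD // external1.
  by move: n2; rewrite inD // external1 external0.
apply/subsetP => _ /imsetP [f + ->]; rewrite inE => ef.
by have := incidence_spread (proj1 tr) u0 u1 u3 ue ef ef1; rewrite /u f1B.
Qed.

End Converse.

(** * From a tree of triangles to a tree-avoiding construction *)

Section Direct.
Variables (I E : {set {set flag}}).
Notation T0 := (G I).
Notation dends := (@dual_ends tet).
Notation ext := (external T I).
Hypothesis Isub : I \subset triangles T.
Hypothesis Itree : is_tree [set: tet] I dends.
Hypothesis htr : is_tree_of_triangles T I E.
Hypothesis hcut : Cut_spanning_tree T I E.
Notation n := #|ext_triangles T I|.
Notation k := #|Cut T I E|.
Notation m := #|edge T @: ExtN I E|.

Lemma Cut_two_ended : two_ended (cut_edge_ends T I E) (Cut T I E).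
Proof.
move=> s /imsetP [f + ->]; rewrite inE => /andP [ef _].
by exists (cut_vertex T I E f), (cut_vertex T I E (a0 f)); apply: cut_edge_endsE.
Qed.

(** A tree with [k] edges has [k + 1] vertices; combine [card_cut_vertices] with
    [m + k = 2 n + 1]. *)
Lemma card_Cut_le : m <= n /\ n < k.
Proof.
have cv : #|cut_vertices T I E| = k.+1.
  apply: tree_card Cut_two_ended _ hcut => s /imsetP [f + ->]; rewrite inE => /andP [ef _].
  rewrite cut_edge_endsE //; apply/subsetP => v /set2P [] ->; apply: imset_f; rewrite inE //.
  by rewrite external0.
have := card_cut_vertices E Isub; have := tree_of_triangles_card Isub htr; rewrite cv; lia.
Qed.

(** Each side at an edge end has two flags there, [f] and [T f], of opposite signs; keeping only the
    even ones counts each side of the triangles of [c] once. *)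
Definition even_flags (c : {set {set flag}}) h :=
  [set f in edge_end T h | ~~ sgn f && (tri f \in c)].

Lemma in_even_flags c f h :
  (f \in even_flags c h) = (f \in edge_end T h) && (~~ sgn f && (tri f \in c)).
Proof. exact: in_set. Qed.

Lemma even_fibers (X W : finType) (phi : X -> W) (D : {set X}) :
  (forall x, x \in D -> ~~ odd #|[set y in D | phi y == phi x]|) -> ~~ odd #|D|.
Proof.
move=> h; rewrite -sum1_card (partition_big_imset phi) /=.
elim/big_ind: _ => // [a b|w /imsetP [x xD ->]]; first by rewrite oddD => /negbTE-> /negbTE->.
by rewrite sum1dep_card; apply: h.
Qed.

(** Exactly one of [f] and [T f] is even. *)
Lemma odd_pair (P : pred flag) f : P f -> P (T f) ->
  (forall h, P h -> h = f \/ h = T f) -> odd #|[set h | ~~ sgn h && P h]|.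
Proof.
move=> Pf PT only; pose g := if sgn f then T f else f.
rewrite (_ : [set h | _] = [set g]) ?cards1 //.
have gE : ~~ sgn g && P g.
  by rewrite /g; case sf: (sgn f); rewrite ?T_sgn ?sf ?PT ?Pf.
apply/setP => h; rewrite !inE; apply/idP/eqP => [/andP [sh /only e]|-> //].
case: e sh => ->; rewrite /g ?T_sgn; first by move/negbTE->.
by rewrite negbK => ->.
Qed.

(* The sides in [E] of the triangles of [c] form an even subgraph of [Cut E]; if there
   are none, all degrees are at least 2 in the incidence graph of [c]. *)
Lemma no_even_chain (c : {set {set flag}}) : c \subset ext_triangles T I ->
  (forall h, h \in ExtN I E -> ~~ odd #|even_flags c h|) -> c = set0.
Proof.
move=> csub ev; apply/eqP; apply: contraT => c0.
have cext f : tri f \in c -> ext f.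
  by move/(subsetP csub) => /imsetP [h]; rewrite inE /external => hI ->.
pose bd := side T @: [set f | (tri f \in c) && (edge T f \in E)].
have sides f h : side T h = side T f -> h = f \/ h = T f \/ h = a0 f \/ h = a0 (T f).
  move=> e; have : h \in side T f by rewrite -e mem_cell.
  by rewrite side_in !inE => /or4P [] /eqP->; auto.
have [bd0|bdN0] := eqVneq bd set0.
  have cN f : tri f \in c -> edge T f \notin E.
    move=> fc; apply/negP => fE; have : side T f \in bd by apply: imset_f; rewrite inE fc.
    by rewrite bd0 inE.
  pose es := side T @: [set f | tri f \in c].
  have es_sub : es \subset ext_sides T I.
    by apply/subsetP => _ /imsetP [f + ->]; rewrite inE => fc; apply: imset_f; rewrite inE;
      apply: cext.
  have [||s [x [y [/imsetP [f]]]]] := acyclic_leaf _ (acyclicS es_sub (proj2 htr)).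
  - by move=> s /(subsetP es_sub); apply: incidence_two_ended.
  - case/set0Pn: c0 => t tc; have /imsetP [f _ et] := subsetP csub t tc.
    by apply/set0Pn; exists (side T f); apply: imset_f; rewrite inE -et.
  rewrite inE => fc -> ends xy leaf.
  have inc h : tri h \in c -> x \in [set inl (tri h);
    inr (cut_edge T E h)] -> side T h = side T f.
    by move=> hc xh; apply: leaf; [apply: imset_f; rewrite inE | rewrite incidence_endsE].
  have : x \in [set inl (tri f); inr (cut_edge T E f)] by rewrite -incidence_endsE ends set21.
  (* A triangle cannot be a leaf, having several sides; an edge cannot either, since its degree in
     [c] would be one. *)
  case/set2P => ex.
    have : side T (a1 f) = side T f by apply: inc; rewrite tri1 // ex set21.
    have nT h : facet h = facet f -> h <> T f by move=> e eh; have := T_facet f;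
      rewrite -eh e eqxx.
    case/sides => [|[|[|]]] e.
    - by have := sgn1 f; rewrite e; case: (sgn f).
    - by case: (nT _ (facet1 f) e).
    - by have := corner0 f; rewrite -e corner1 eqxx.
    - have e' : facet (a0 (a1 f)) = facet f by rewrite facet0 facet1.
      by case: (nT _ e'); rewrite e a0K.
  have fN : f \in ExtN I E by rewrite inE cext //= cN.
  have := ev f fN; rewrite (_ : even_flags c f = [set h | ~~ sgn h && ((h \in edge_end T f) &&
    (tri h \in c))]).
    rewrite (odd_pair (f := f)) ?mem_cell ?tri3 ?fc //=.
      by rewrite andbT /edge_end -(cell_eqE TK) (cell3 TK).
    move=> h /andP [hf hc].
    have : side T h = side T f.
      apply: inc => //; rewrite ex !cut_edgeE (edge_end_edge hf) (negbTE (cN f fc)); exact: set22.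
    case/sides => [|[|[|]]] e; auto; exfalso; move: hf; rewrite e; apply/negP;
      first exact: a0_end.
    by rewrite -(edge_end3 f); apply: a0_end.
  by apply/setP => h; rewrite !in_set andbCA.
have bd_sub : bd \subset Cut T I E.
  apply/subsetP => _ /imsetP [f + ->]; rewrite inE => /andP [fc fE].
  by apply: imset_f; rewrite inE fE andbT; apply: cext.
have [||s [v [v' [/imsetP [f0]]]]] := acyclic_leaf _ (acyclicS bd_sub (proj2 hcut)) => //.
  by move=> s /(subsetP bd_sub); apply: Cut_two_ended.
rewrite inE => /andP [f0c f0E] -> ends vv' leaf.
have [f [fc fE sf cf cf']] : exists f, [/\ tri f \in c, edge T f \in E, side T f = side T f0,
    cut_vertex T I E f = v & cut_vertex T I E (a0 f) = v'].
  have ef0 := cext _ f0c.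
  have h1 : v \in [set cut_vertex T I E f0; cut_vertex T I E (a0 f0)].
    by rewrite -cut_edge_endsE // ends set21.
  have h2 : v' \in [set cut_vertex T I E f0; cut_vertex T I E (a0 f0)].
    by rewrite -cut_edge_endsE // ends set22.
  case/set2P: h1 => e1; case/set2P: h2 => e2; try by move: vv'; rewrite e1 e2 eqxx.
    by exists f0.
  by exists (a0 f0); rewrite tri0 edge0 a0K /side (cell0 TK).
have ef := cext _ fc.
(* Count the even flags of [c] at the leaf [v] of [bd]: they are paired by [a1] followed by [T];
   those on edges outside [E] are even in number by hypothesis, whereas on edges of [E] there is
   only one of [f] and [T f]. *)
pose P h := (h \in cut_vertex T I E f) && (tri h \in c).
have PV h : P h -> cut_vertex T I E h = v by case/andP => /cut_vertex_eq ->.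
have odE : odd #|[set h | ~~ sgn h && (P h && (edge T h \in E))]|.
  apply: (@odd_pair (fun h => P h && (edge T h \in E)) f).
  - by rewrite /P mem_cut_vertex fc fE.
  - by rewrite /P -(cut_vertex3 E ef) mem_cut_vertex tri3 edge3 fc fE.
  move=> h /andP [Ph hE']; have hv := PV h Ph; have hc : tri h \in c by case/andP: Ph.
  have : side T h = side T f.
    rewrite sf; apply: leaf; first by apply: imset_f; rewrite inE hc hE'.
    by rewrite cut_edge_endsE ?cext // hv set21.
  case/sides => [|[|[|]]] e; auto; exfalso; case/eqP: vv'; rewrite -hv -cf' e //.
  by rewrite -T_a0 cut_vertex3 ?external0.
have evN : ~~ odd #|[set h | ~~ sgn h && (P h && (edge T h \notin E))]|.
  apply: (@even_fibers _ _ (edge_end T)) => x; rewrite inE => /and3P [sx Px xE].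
  have xc : tri x \in c by case/andP: Px.
  have xN : x \in ExtN I E by rewrite inE cext.
  rewrite (_ : [set _ in _ | _] = even_flags c x); first exact: ev.
  apply/setP => h; rewrite in_even_flags [LHS]in_set [X in X && _]in_set [X in _ && X](cell_eqE
    TK).
  apply/andP/andP => [[/and3P [sh /andP [_ hc] _] hx]|[hx /andP [sh hc]]].
    by split=> //; rewrite sh.
  rewrite sh /P hc (edge_end_edge hx) xE !andbT; split=> //.
  have -> : cut_vertex T I E f = cut_vertex T I E x by rewrite cf (PV x).
  by rewrite -(cut_vertex_end (cext _ xc) (cext _ hc) xE hx) mem_cut_vertex.
have evA : ~~ odd #|[set h | ~~ sgn h && P h]|.
  apply: (@even_involution _ (fun h => T (a1 h))) => h; rewrite inE => /andP [sh Ph].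
  have hc : tri h \in c by case/andP: Ph.
  have e : cut_vertex T I E f = cut_vertex T I E (T (a1 h)).
    by rewrite cut_vertex3 ?cut_vertex1 ?external1 ?cext // (PV h) ?cf.
  split; last 2 first.
  - by rewrite T_a1 TK a1K.
  - by apply: contraNneq (T_facet (a1 h)) => ->; rewrite facet1.
  by rewrite inE T_sgn sgn1 negbK sh /P e mem_cut_vertex tri3 tri1 hc.
move: evA; rewrite -(cardsID [set h | edge T h \in E]) oddD.
rewrite (_ : _ :&: _ = [set h | ~~ sgn h && (P h && (edge T h \in E))]); last first.
  by apply/setP => h; rewrite !in_set andbA.
rewrite (_ : _ :\: _ = [set h | ~~ sgn h && (P h && (edge T h \notin E))]); last first.
  by apply/setP => h; rewrite !in_set andbC andbA.
by rewrite odE (negbTE evN).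
Qed.

(** [a0] after [T] preserves sign and triangle, and sends one end of the edge into the other. *)
Lemma card_even_flags0 c h : #|even_flags c h| <= #|even_flags c (a0 h)|.
Proof.
have inj : injective (fun x => a0 (T x)) by move=> x y /(can_inj (@a0K tet))/(can_inj TK).
rewrite -(card_imset (even_flags c h) inj); apply: subset_leq_card.
apply/subsetP => _ /imsetP [x + ->]; rewrite inE => /andP [xh /andP [sx xc]].
rewrite inE sgn0 T_sgn negbK sx tri0 tri3 xc !andbT.
apply: (edge_end_a0 TK T_a0); by rewrite /edge_end -(cell_eqE TK) (cell3 TK) // (cell_eqE TK).
Qed.

Lemma card_even_flags c h x : edge T x = edge T h -> #|even_flags c x| = #|even_flags c h|.
Proof.
have same y : y \in edge_end T h -> even_flags c y = even_flags c h.
  by move=> yh; rewrite /even_flags /edge_end (cell_eq TK yh).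
case/edge_same => /same; first by move->.
move=> <-; apply/eqP; rewrite eqn_leq card_even_flags0.
by have := card_even_flags0 c (a0 x); rewrite a0K => ->.
Qed.

(* Otherwise the forest of the triangles outside [J] and their edges not in [E] has
   fewer edges of [T] than triangles, so that two sets of triangles have the same
   parities at all of these edges. *)
Lemma exists_free J f0 : I \subset J -> tri f0 \notin J ->
  exists a, [/\ tri a \notin J, edge T a \notin E & free J a].
Proof.
move=> IJ f0J.
pose crowded f := [exists h in edge_end T f, [&& tri h \notin J, h != f & h != T f]].
case: (boolP [exists a, [&& tri a \notin J, edge T a \notin E & ~~ crowded a]]).
  case/existsP => a /and3P [aJ aE /existsP nc]; exists a; split=> // f fa fJ.
  have [|n1] := eqVneq f a; first by left.
  have [|n2] := eqVneq f (T a); first by right.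
  by case: nc; exists f; rewrite fa fJ n1 n2.
move=> /existsP none; exfalso.
have crowd f : tri f \notin J -> edge T f \notin E -> crowded f.
  by move=> fJ fE; apply: contraT => nc; case: none; exists f; rewrite fJ fE nc.
pose R := triangles T :\: J; pose D := [set f | (tri f \notin J) && (edge T f \notin E)].
pose M := edge T @: D; pose S := side T @: D.
have inR f : (tri f \in R) = (tri f \notin J) by rewrite inE imset_f ?andbT.
have extJ f : tri f \notin J -> ext f by apply: contra => /(subsetP IJ).
have S2 : 2 * #|M| <= #|S|.
  (* A side determines its edge; the default value [set0] is never reached, as a side is
     nonempty. *)
  pose phi (s : {set flag}) := if [pick f in s] is Some f then edge T f else set0.
  have phiE f : phi (side T f) = edge T f.
    rewrite /phi; case: pickP => [h|/(_ f)]; last by rewrite /= mem_cell.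
    by rewrite side_in !inE => /or4P [] /eqP->; rewrite ?edge0 ?edge3.
  have -> : M = phi @: S by rewrite -imset_comp; apply: eq_imset => f; rewrite /= phiE.
  apply: card_fibers_ge => _ /imsetP [f fD ->].
  have := fD; rewrite inE => /andP [fJ fE].
  have /existsP [h /andP [hf /and3P [hJ n1 n2]]] := crowd f fJ fE.
  have hD : h \in D by rewrite inE hJ (edge_end_edge hf).
  rewrite (_ : 2 = #|[set side T f; side T h]|); last first.
    rewrite cards2; case: eqP => // e.
    have : h \in side T f by rewrite e mem_cell.
    rewrite side_in !inE (negbTE n1) (negbTE n2) /= => /orP [] /eqP eh; case/negP: (a0_end f).
      by rewrite -eh.
    by move: hf; rewrite eh -(edge_end3 f) => h'; case/negP: (a0_end (T f)).
  apply: subset_leq_card; apply/subsetP => s /set2P [] ->; rewrite in_set !phiE ?eqxx ?andbT.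
    exact: imset_f.
  by rewrite (edge_end_edge hf) eqxx andbT; apply: imset_f.
(* The sides in [S] join [R] to [M] in a forest, and each edge in [M] has at least two of them, so
   [2 #|M| <= #|S| < #|R| + #|M|]. *)
have MR : #|M| < #|R|.
  pose vs : {set {set flag} + {set flag}} := inl @: R :|: inr @: M.
  have cvs : #|vs| = #|R| + #|M|.
    rewrite cardsU (_ : _ :&: _ = set0) ?cards0 ?subn0 ?(card_imset _ inl_inj) ?(card_imset _
      inr_inj) //.
    by apply/setP => x; rewrite !inE; apply/negP => /andP [/imsetP [y _ ->] /imsetP [z]].
  have S_sub : S \subset ext_sides T I.
    apply/subsetP => _ /imsetP [f + ->]; rewrite inE => /andP [fJ _].
    by apply: imset_f; rewrite inE; apply: extJ.
  have f0v : inl (tri f0) \in vs by rewrite inE imset_f ?inR.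
  have : #|S| < #|vs|.
    apply: (acyclic_card _ (acyclicS S_sub (proj2 htr)) _ f0v).
      by move=> s /(subsetP S_sub); apply: incidence_two_ended.
    move=> _ /imsetP [f fD ->]; rewrite incidence_endsE; apply/subsetP => x.
    have := fD; rewrite inE => /andP [fJ fE].
    case/set2P => ->; rewrite inE; apply/orP; [left | right]; apply: imset_f;
      first by rewrite inR.
    by rewrite cut_edgeE (negbTE fE); apply: imset_f.
  rewrite cvs; lia.
(* Edges at which a set of triangles has odd degree; two sets with the same image differ by an even
   chain. *)
pose psi (c : {set {set flag}}) := [set e in M | [exists h in e, odd #|even_flags c h|]].
have psiE c h : edge T h \in M -> (edge T h \in psi c) = odd #|even_flags c h|.
  move=> hM; rewrite in_set hM /=; apply/existsP/idP => [[x /andP [xh]]|od]; last first.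
    by exists h; rewrite mem_cell.
  by rewrite (@card_even_flags c h x) //; apply: (cell_eq TK).
have Rsub (c : {set {set flag}}) : c \subset R -> c \subset ext_triangles T I.
  move=> cR; apply/subsetP => t /(subsetP cR); rewrite inE => /andP [tJ /imsetP [f _ et]].
  by rewrite et in tJ *; apply: imset_f; rewrite inE; apply: extJ.
have inj : {in powerset R &, injective psi}.
  move=> c1 c2; rewrite !inE => c1R c2R e.
  have par h : h \in ExtN I E -> odd #|even_flags c1 h| = odd #|even_flags c2 h|.
    rewrite inE => /andP [eh hE']; case: (boolP (edge T h \in M)) => [hM|hM].
      by rewrite -!psiE // e.
    have none' (c : {set {set flag}}) : c \subset R -> even_flags c h = set0.
      move=> cR; apply/setP => x; rewrite in_even_flags in_set0;
        apply/negP => /andP [xh /andP [_ xc]].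
      case/negP: hM; rewrite -(edge_end_edge xh); apply: imset_f.
      by rewrite inE (edge_end_edge xh) hE' andbT -inR (subsetP cR).
    by rewrite !none'.
  have : (c1 :\: c2) :|: (c2 :\: c1) = set0.
    apply: no_even_chain.
      by apply: Rsub; rewrite subUset !(subset_trans (subsetDl _ _)).
    move=> h /par; pose A := even_flags c1 h; pose B := even_flags c2 h => pAB.
    have -> : even_flags (c1 :\: c2 :|: c2 :\: c1) h = (A :\: B) :|: (B :\: A).
      apply/setP => x; rewrite in_even_flags !in_setU !in_setD !in_even_flags.
      by case: (_ \in edge_end T h); case: (sgn x); case: (_ \in c1); case: (_ \in c2).
    rewrite cardsU (_ : _ :&: _ = set0) ?cards0 ?subn0.
      by move: pAB; rewrite -/A -/B -(cardsID B A) -(cardsID A B) setIC !oddD; do 3!case: (odd _).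
    apply/setP => x; rewrite in_setI !in_setD in_set0.
    by case: (x \in A); case: (x \in B).
  move/eqP; rewrite setU_eq0 !setD_eq0 => /andP [s1 s2]; apply/eqP; by rewrite eqEsubset s1.
have : #|powerset R| <= #|powerset M|.
  rewrite -(card_in_imset inj); apply: subset_leq_card; apply/subsetP => _ /imsetP [c _ ->].
  by rewrite powersetE; apply/subsetP => x; rewrite inE => /andP [].
by rewrite !card_powerset leq_exp2l // leqNgt MR.
Qed.

(** Repeat [exists_free], with [p] bounding the number of unglued triangles. *)
Lemma exists_foldings J : I \subset J -> J \subset triangles T ->
  exists2 s, foldings J s & forall a, a \in s -> edge T a \notin E.
Proof.
move: {2}#|triangles T :\: J| (leqnn #|triangles T :\: J|) => p.
elim: p J => [|p IH] J cJ IJ JT.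
  exists [::] => // f /=; apply: contraT => fJ; move: cJ.
  by rewrite leqn0 cards_eq0 => /eqP/setP/(_ (tri f)); rewrite !inE fJ imset_f.
case: (boolP [exists f, tri f \notin J]) => [/existsP [f0 f0J]|/existsP none]; last first.
  by exists [::] => // f /=; apply: contraT => fJ; case: none; exists f.
have [a [aJ aE fr]] := exists_free IJ f0J.
have aT : tri a \in triangles T by apply: imset_f.
have [||| s fs sE] := IH (tri a |: J).
- rewrite -ltnS; apply: leq_trans cJ; apply: proper_card; rewrite properE; apply/andP; split.
    by apply: setDS; apply: subsetUr.
  by apply/subsetPn; exists (tri a); rewrite !inE ?aJ ?aT ?eqxx.
- by apply: subset_trans IJ (subsetUr _ _).
- by rewrite subUset sub1set aT JT.
by exists (a :: s) => [|b]; [| rewrite inE => /orP [/eqP->|/sE]].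
Qed.

(** * The preimage of [E] on the boundary, and the dual graph of its complement *)

Let fx f : ext f -> T0 f = f. Proof. exact: G_fixedP. Qed.
Let mend f : ext f -> mate T0 f \in edge_end T0 f.
Proof. by move/fx => gf; have [] := mateP (GK I) gf. Qed.
Let em f : ext f -> ext (mate T0 f).
Proof. by move/fx => gf; have [_ + _] := mateP (GK I) gf; move/eqP; rewrite G_fixed. Qed.
(** Ends in the dual graph of the boundary, whose vertices are the external facets. *)
Definition facet_ends (e : {set flag}) := [set facet f | f in [set f in e | ext f]].

Lemma facet_endsE f : ext f -> facet_ends (edge T0 f) = [set facet f; facet (mate T0 f)].
Proof.
move=> ef; apply/setP => x; apply/imsetP/set2P => [[h]|].
  rewrite in_set => /andP [hf eh] ->; move: hf; rewrite (edge_mem (GK I) (G_a0 I)) => /orP [] hf.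
    by have [->|->] := mate_unique (GK I) (fx ef) hf (fx eh); auto.
  have eh' : T0 (a0 h) = a0 h by rewrite G_a0 fx.
  by rewrite -(facet0 h); have [->|->] := mate_unique (GK I) (fx ef) hf eh'; auto.
have in1 h : h \in edge_end T0 f -> h \in edge T0 f.
  by move=> hf; rewrite (edge_mem (GK I) (G_a0 I)) hf.
case=> ->; [exists f | exists (mate T0 f)] => //; rewrite in_set ?ef ?em // andbT.
  exact: mem_cell.
by apply: in1; apply: mend.
Qed.

Lemma facet_two_ended : two_ended facet_ends (edge T0 @: ExtN I E).
Proof.
move=> e /imsetP [f + ->]; rewrite inE => /andP [ef _].
by exists (facet f), (facet (mate T0 f)); apply: facet_endsE.
Qed.

(** A marking [z] of facets, constant across boundary edges not over [E], takes the same value on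
    both facets of a triangle: otherwise [exists_free] finds an edge end where a single side has
    facets with different values, against parity. Then [z] is a marking of triangles and
    [incidence_spread] applies. *)
Lemma facet_graph_connected : connected_graph (facet @: Ext I) (edge T0 @: ExtN I E) facet_ends.
Proof.
have [t _] : exists t : tet, true.
  by have /andP [/set0Pn [t _] _] := proj1 Itree; exists t.
have [f0 _ ef0] := edge_has_boundary Isub Itree (t, 1%g).
apply: (@closed_connected _ _ _ _ _ (facet f0)); first by apply: imset_f; rewrite inE.
move=> B _ /imsetP [f1 + ->]; rewrite inE => ef1 f1B clB.
pose z f := facet f \in B.
have z0 f : z (a0 f) = z f by rewrite /z facet0.
have z1 f : z (a1 f) = z f by rewrite /z facet1.
have zm f : ext f -> edge T f \notin E -> z (mate T0 f) = z f.
  move=> ef fE; have sf : edge T0 f \in edge T0 @: ExtN I E by apply: imset_f; rewrite inE ef.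
  by apply/idP/idP; apply: clB sf _; rewrite facet_endsE // setUC.
(* Extension of [z] to the interior flags around an edge, consistent with [z] at the edges outside
   [E]. *)
pose y h := [exists x in edge_end T0 h, ext x && z x].
have yP h : reflect (exists2 x, x \in edge_end T0 h & ext x && z x) (y h) by apply: exists_inP.
have yz f : ext f -> edge T f \notin E -> y f = z f.
  move=> ef fE; apply/yP/idP => [[x xf /andP [ex zx]]|zf].
    by have [<-|e] := mate_unique (GK I) (fx ef) xf (fx ex); rewrite // -zm // -e.
  by exists f; [exact: mem_cell | rewrite ef].
have y2 f : y (a2 f) = y f by rewrite /y /edge_end (cell2 (GK I)).
have y3 f : tri f \in I -> y (T f) = y f.
  by move=> fI; rewrite -(G_glued fI) /y /edge_end (cell3 (GK I)).
have z3 f : ext f -> z (T f) = z f.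
  move=> ef; apply/eqP; apply: contraT => badf.
  pose bad x := ext x && (z (T x) != z x).
  have badtri x x' : tri x' = tri x -> bad x -> bad x'.
    move=> + bx; move/eqP; rewrite tri_eqE => /orP [] /eqP.
      by apply: (@facet_ind tet bad) => // h;
        rewrite /bad ?external0 ?external1 ?T_a0 ?T_a1 ?z0 ?z1.
    apply: (@facet_ind tet bad) => [h|h|];
      rewrite /bad ?external0 ?external1 ?T_a0 ?T_a1 ?z0 ?z1 //.
    by rewrite TK external3 eq_sym.
  (* With every triangle whose facets agree counted as glued, a free side is the only bad one at its
     edge end. *)
  pose J := triangles T :\: tri @: [set x | bad x].
  have inJ x : (tri x \in J) = ~~ bad x.
    have xT : tri x \in triangles T by apply: imset_f.
    rewrite in_setD xT andbT; congr (~~ _); apply/imsetP/idP => [[h + e]|bx].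
      by rewrite inE; apply: badtri.
    by exists x; rewrite ?inE.
  have IJ : I \subset J.
    apply/subsetP => t' t'I; have /imsetP [x _ ex] := subsetP Isub t' t'I.
    by rewrite ex inJ /bad /external -ex t'I.
  have [|a [aJ aE fr]] := @exists_free J f IJ; first by rewrite inJ negbK /bad ef.
  have main b : bad b -> edge T b \notin E -> free J b -> z b -> false.
    move=> bb bE frb zb; have /andP [eb nzb] := bb.
    (* Marked flags around the edge: closed under [a2], and under [T] except possibly at the bad
       side, which [odd_crossing] takes care of. *)
    pose W := [set h in edge_end T b | y h].
    have inW h : (h \in W) = (h \in edge_end T b) && y h by exact: in_set.
    have : T b \in W.
      apply: odd_crossing => [h|h|]; rewrite !inW.
      - by rewrite y2 /edge_end -!(cell_eqE TK) (cell2 TK).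
      - move=> /andP [hb yh] n1 n2; have hb' : T h \in edge_end T b.
          by rewrite /edge_end -(cell_eqE TK) (cell3 TK) // (cell_eqE TK).
        rewrite hb' /=; case: (boolP (tri h \in I)) => [/y3 -> //|eh].
        have hE' : edge T h \notin E by rewrite (edge_end_edge hb).
        have hJ : tri h \in J.
          by apply: contraT => hJ; have [e|e] := frb h hb hJ;
            [rewrite e eqxx in n1 | rewrite e eqxx in n2].
        move: hJ yh; rewrite inJ /bad /external eh /= negbK => /eqP zT.
        by rewrite !yz ?external3 ?edge3 // zT.
      by rewrite mem_cell yz.
    rewrite inW yz ?external3 ?edge3 // => /andP [_ zT].
    by move: nzb; rewrite zT zb.
  have ba : bad a by rewrite -[bad a]negbK -inJ.
  (* Exactly one of the two facets of a bad triangle is marked; [main] is applied to that one. *)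
  case za: (z a); first by have := main a ba aE fr za.
  have bTa : bad (T a) by apply: badtri ba; rewrite tri3.
  apply: (main (T a)) => //; rewrite ?edge3 //.
    move=> h; rewrite edge_end3 TK => ha hJ.
    by have [->|->] := fr h ha hJ; auto.
  by have /andP [_] := ba; rewrite za; case: (z _).
have ze f h : ext f -> ext h -> edge T f \notin E -> h \in edge_end T f -> z h = z f.
  move=> ef eh fE hf; have : edge T h = edge T f /\ y h = y f.
    move: h hf {eh}; apply: edge_end_ind => [x [ex yx]|x [ex yx]|//].
      by rewrite edge2 y2.
    rewrite edge3; split=> //; case: (boolP (tri x \in I)) => [/y3 -> //|xI].
    by rewrite yz ?external3 ?edge3 ?ex // z3 // -yz ?ex.
  by case=> ehf; rewrite !yz ?ehf.
have := @incidence_spread I E z (proj1 htr) (fun f _ => z0 f) (fun f _ => z1 f) z3 ze => same.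
apply/subsetP => _ /imsetP [f + ->]; rewrite inE => ef.
by have := same f f1 ef ef1; rewrite /z f1B.
Qed.

(** There are [2 n] facets and at most [3 n - k] edges, which is less than [2 n] as [k > n]. *)
Lemma facet_graph_acyclic : acyclic facet_ends (edge T0 @: ExtN I E).
Proof.
apply: connected_acyclic facet_graph_connected _.
have c2 : #|facet @: Ext I| = 2 * n.
  have : #|Ext I| = 6 * #|facet @: Ext I|.
    apply: card_fibers => f; rewrite inE => ef; rewrite -(card_facet f); apply: eq_card => h.
    rewrite !in_set; apply: andb_idl => /eqP.
    by apply: (@facet_ind tet ext) => // x; rewrite ?external0 ?external1.
  rewrite card_Ext; lia.
have sat f h : f \in ExtN I E -> ext h -> h \in edge T0 f -> h \in ExtN I E.
  move=> fN eh hf; have fE : edge T f \notin E by move: fN; rewrite inE => /andP [].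
  rewrite inE eh; have -> : edge T h = edge T f by exact: (cellG_cell (cell_eq (GK I) hf)).
  exact: fE.
have Next f : f \in ExtN I E -> ext f by rewrite inE => /andP [].
have := card_bd_edges sat Next; have := card_ExtEN I E; rewrite card_ExtE.
have [_ nk] := card_Cut_le; rewrite c2; lia.
Qed.

(** Boundary edges with a single end in [B] are not over [E], hence form a forest in the acyclic
    dual graph; a leaf facet has a single such side, against [third_corner]. *)
Lemma bd_connected : connected_graph (bd_vertices T0) (edge T0 @: ExtE I E) (edge_ends T0).
Proof.
have [t _] : exists t : tet, true.
  by have /andP [/set0Pn [t _] _] := proj1 Itree; exists t.
have [f0 _ ef0] := edge_has_boundary Isub Itree (t, 1%g).
have bdv f : ext f -> vertex T0 f \in bd_vertices T0.
  by move=> ef; apply: imset_f; rewrite inE G_fixed.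
apply: (@closed_connected _ _ _ _ _ (vertex T0 f0)); first exact: bdv.
move=> B _ /imsetP [f1 + ->]; rewrite inE G_fixed => ef1 f1B clB.
pose u f := vertex T0 f \in B.
have u1 f : u (a1 f) = u f by rewrite /u /vertex (cell1 (GK I)).
have um f : ext f -> u (mate T0 f) = u f.
  move=> /mend h; rewrite /u; congr (_ \in B).
  by apply: (cell_fold (GK I) _ h) => i; rewrite !inE => ->.
have uE f : ext f -> edge T f \in E -> u (a0 f) = u f.
  move=> ef fE; have sf : edge T0 f \in edge T0 @: ExtE I E by apply: imset_f; rewrite inE ef.
  by apply/idP/idP; apply: clB sf _; rewrite edge_endsE // setUC.
have u0 f : ext f -> u (a0 f) = u f.
  move=> ef; apply/eqP; apply: contraT => bad.
  pose D := edge T0 @: [set f in ExtN I E | u f != u (a0 f)].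
  have inD x : ext x -> u x != u (a0 x) -> edge T0 x \in D.
    move=> ex ux; apply: imset_f; rewrite !in_set ex ux andbT /=.
    by apply: contraNN ux => xE; rewrite uE.
  have D_sub : D \subset edge T0 @: ExtN I E.
    by apply/subsetP => _ /imsetP [x + ->]; rewrite in_set => /andP [xN _]; apply: imset_f.
  have [||ee [v [v' [/imsetP [x0]]]]] := acyclic_leaf _ (acyclicS D_sub facet_graph_acyclic).
  - by move=> e /(subsetP D_sub); apply: facet_two_ended.
  - by apply/set0Pn; exists (edge T0 f); apply: inD => //; rewrite eq_sym.
  rewrite !in_set => /andP [/andP [ex0 x0E] ux0] -> ends vv' leaf.
  have h1 : v \in [set facet x0; facet (mate T0 x0)] by rewrite -facet_endsE // ends set21.
  have h2 : v' \in [set facet x0; facet (mate T0 x0)] by rewrite -facet_endsE // ends set22.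
  have [x [ex xe xv ux]] : exists x, [/\ ext x, edge T0 x = edge T0 x0,
    facet x = v & u x != u (a0 x)].
    case/set2P: h1 => ->; first by exists x0.
    exists (mate T0 x0); split=> //; [exact: em | |].
      by apply: (cell_fold (GK I) _ (mend ex0)) => i; rewrite !inE => ->; rewrite orbT.
    by rewrite um // -(mate_a0 (GK I) (G_a0 I) (fx ex0)) um ?external0.
  have nm : facet (mate T0 x) <> v.
    move=> e; have : v' \in [set facet x; facet (mate T0 x)].
      by rewrite -facet_endsE // xe ends set22.
    by rewrite xv e => /set2P [] ev; move: vv'; rewrite ev eqxx.
  have final h : facet h = facet x -> h <> x -> h <> a0 x -> u h != u (a0 h) -> false.
    move=> hx n1 n2 uh.
    have eh : ext h.
      by move: hx; apply: (@facet_ind tet ext) => // q; rewrite ?external0 ?external1.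
    have : edge T0 h = edge T0 x.
      rewrite xe; apply: leaf; first exact: inD.
      by rewrite facet_endsE // hx xv set21.
    move=> e; have : h \in edge T0 x by rewrite -e; exact: mem_cell.
    rewrite (edge_mem (GK I) (G_a0 I)) => /orP [] hx'.
      by have [//|e'] := mate_unique (GK I) (fx ex) hx' (fx eh); case: nm; rewrite -e' hx.
    have gh : T0 (a0 h) = a0 h by rewrite G_a0 fx.
    have [e'|e'] := mate_unique (GK I) (fx ex) hx' gh; first by case: n2; rewrite -e' a0K.
    by case: nm; rewrite -e' facet0 hx.
  have [//|uh|uh] := third_corner _ ux; apply: final uh; rewrite ?facet1 ?facet0 // => e.
  - by have := sgn1 x; rewrite e; case: (sgn x).
  - by have := corner0 x; rewrite -e corner1 eqxx.
  - by have := corner0 x; rewrite -(corner1 (a0 x)) e eqxx.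
  - by have := sgn1 (a0 x); rewrite e; case: (sgn _).
apply/subsetP => _ /imsetP [f + ->]; rewrite inE G_fixed => ef.
by have := boundary_spread Isub Itree u0 (fun f _ => u1 f) um ef ef1; rewrite /u f1B.
Qed.

End Direct.

(** * The two directions put together *)

Theorem construction_iff I E : tetrahedra_spanning_tree T I -> edge_spanning_tree T E ->
  in_TT T I E <->
  exists w : seq (flag * flag),
    [/\ local_construction (G I) w T, tree_avoiding (G I) w & critical_tree T w = E].
Proof.
case=> Isub Itree hE.
have critE s : critical_tree T [seq (a, T a) | a <- s] = edges T :\: [set edge T a | a in s].
  congr (_ :\: _); apply/setP => e; apply/imsetP/imsetP => [[ab /mapP [a as_ ->] ->]|[a as_ ->]].
    by exists a.
  by exists (a, T a) => //; apply: map_f.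
split; last first.
  case=> w [/(constructionP I) [s ws fs] [E0 [hE0 av]] crit].
  rewrite {w}ws in av crit; apply: (in_TT_converse Isub Itree hE hE0 fs av).
  by rewrite -critE.
case=> htr hcut.
have [s fs sE] := exists_foldings Isub htr hcut (subxx I) Isub.
have sN : [set edge T a | a in s] \subset edges T :\: E.
  apply/subsetP => _ /imsetP [a /sE aE ->]; rewrite inE aE; exact: imset_f.
have [mn nk] := card_Cut_le Isub htr hcut.
have card_s := foldings_card fs Isub; have card_t := card_triangles Isub.
have eN := nonE_edges E Isub Itree.
(* [foldings_card] gives [n] folded edges, and there are [m <= n] edges outside [E]. *)
have sEq : [set edge T a | a in s] = edges T :\: E.
  by apply/eqP; rewrite eqEcard sN /= -eN -(leq_add2r #|I|) card_s -card_t leq_add2r.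
pose C := [set f | edge T f \in E].
have clC x : x \in C -> [/\ a0 x \in C, a2 x \in C & T x \in C].
  by rewrite !inE edge0 edge2 edge3.
exists [seq (a, T a) | a <- s]; split.
- by apply/constructionP; exists s.
- exists (edge (G I) @: C); split; last first.
    by apply: foldings_avoid => // a /sE; rewrite inE.
  (* Every edge of the tree of tetrahedra reaches the boundary, so the preimage of [E] consists of
     boundary edges. *)
  have -> : edge (G I) @: C = edge (G I) @: ExtE I E.
    apply/setP => e; apply/imsetP/imsetP => [[f fC ->]|[f + ->]]; last first.
      by rewrite inE => /andP [_ fE]; exists f; rewrite ?inE.
    have [h hf hI] := edge_has_boundary Isub Itree f.
    have ehf := edge_end_edge (subsetP (cellG_sub I _ f) h hf).
    exists h; first by rewrite inE /external hI ehf; move: fC; rewrite inE.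
    by apply/esym/(cell_fold (GK I) _ hf) => i; rewrite !inE => ->; rewrite orbT.
  split.
    apply/subsetP => _ /imsetP [f + ->]; rewrite inE => /andP [ef _].
    by apply: imset_f; rewrite inE G_fixed.
  apply: connected_tree (bd_connected Isub Itree htr hcut) _.
  have sat f h : f \in ExtE I E -> external T I h -> h \in edge (G I) f -> h \in ExtE I E.
    move=> fEE eh hf; have fE : edge T f \in E by move: fEE; rewrite inE => /andP [].
    rewrite inE eh; have -> : edge T h = edge T f by exact: (cellG_cell (cell_eq (GK I) hf)).
    exact: fE.
  have Eext f : f \in ExtE I E -> external T I f by rewrite inE => /andP [].
  have := card_bd_edges sat Eext; rewrite card_ExtE leq_pmul2l // => cE0.
  have em : #|edge T @: ExtN I E| = #|ext_triangles T I|.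
    by apply/eqP; rewrite -(eqn_add2r #|I|) card_t -card_s sEq eN.
  (* [m = n] forces [k = n + 1], so this connected graph on at least [n + 2] vertices has at most
     [n + 1] edges and is a tree. *)
  have := tree_of_triangles_card Isub htr; rewrite em mul2n -addnn -addnS => /addnI ek.
  by apply: leq_ltn_trans cE0 _; rewrite ek; apply: card_bd_vertices.
by rewrite critE sEq setDDr setDv set0U; apply/setIidPr; case: hE.
Qed.

End Triangulation.

Theorem theorem25 (tet : finType) (T : {ffun flag tet -> flag tet})
    (I E : {set {set flag tet}}) :
  closed_triangulation T ->
  tetrahedra_spanning_tree T I ->
  edge_spanning_tree T E ->
  in_TT T I E <->
  exists w : seq (flag tet * flag tet),
    [/\ local_construction (tree_of_tetrahedra T I) w T,
        tree_avoiding (tree_of_tetrahedra T I) w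
      & critical_tree T w = E].
Proof. move=> hT hI hE; exact: (construction_iff hT hI hE). Qed.
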